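(* Let the algorithm Perishing-Guardrail be run with envy parameter $L_T=o(1)$, $L_T>0$, high-probability parameter $\delta\in(0,1)$ and, for $t'>t$, with confidence terms $$\mathrm{Conf}^N_{t,t'}=\sqrt{2(t'-t)|\Theta|\rho_{\max}^2\log(2T^2/\delta)},$$ $$\mathrm{Conf}^P_t(\eta_t)=\tfrac12\Big(\log(3t\log T/\delta)+\sqrt{\log^2(3t\log T/\delta)+8\eta_t\log(3t\log T/\delta)}\Big).$$ Then, with probability at least $1-2\delta$, it achieves $$\Delta_{EF}\lesssim\max\{L_T,\ \mathcal L^{\mathrm{perish}}+1/\sqrt T\},$$ $$\Delta_{\mathrm{efficiency}}\lesssim\min\Big\{\sqrt T,\ L_T^{-1}+\sqrt{T L_T^{-1}\mathcal L^{\mathrm{perish}}}\Big\}+T\mathcal L^{\mathrm{perish}},$$ $$\mathrm{Envy}\lesssim L_T .$$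
   Context: Model. A decision-maker has a set $\mathcal B$ of $B$ divisible units of a single resource to allocate over rounds $t\in[T]=\{1,\dots,T\}$. Individuals have types in a finite set $\Theta$; type $\theta$ has utility $w_\theta x$ for an amount $x\ge0$, $w_\theta>0$. In round $t$ a random number $N_{t,\theta}$ of type-$\theta$ individuals arrives; the $N_{t,\theta}$ are independent with known distributions and $N_{t,\theta}\ge1$ a.s. $N_t=\sum_\theta N_{t,\theta}$, $N=\sum_{t\in[T]}N_t$, $\mathbb E[N]=\Theta(T)$, $\beta_{avg}=B/\mathbb E[N]=\Theta(1)$. $\sigma_{t,\theta}^2=\mathrm{Var}(N_{t,\theta})<\infty$; $\rho_{t,\theta}<\infty$ is an almost sure bound on $|N_{t,\theta}-\mathbb E[N_{t,\theta}]|$; $w_{max}=\max_\theta w_\theta$, $\mu_{\max}=\max_t\mathbb E[N_t]$, $\sigma^2_{\min}=\min\sigma^2_{t,\theta}$, $\sigma^2_{\max}=\max\sigma^2_{t,\theta}$, $\rho_{\max}=\max\rho_{t,\theta}$. Unit $b$ has a random perishing time $T_b\in\{1,2,\dots\}$ with known distribution, independent across units and of arrivals; any unallocated part of $b$ spoils at the end of round $T_b$, after that round's allocation. A fixed allocation schedule is a bijection $\sigma:\mathcal B\to\{1,\dots,B\}$; units are handed out in increasing order of $\sigma$ among those still (partly) unallocated and unspoiled. $X^{alg}_{t,\theta}$ is the amount given to each type-$\theta$ individual in round $t$; $B_1^{alg}=B$ and $B_{t+1}^{alg}=B_t^{alg}-\sum_\theta N_{t,\theta}X^{alg}_{t,\theta}-PUA^{alg}_t$,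 with $PUA_t^{alg}$ the quantity of unallocated resource perishing at the end of round $t$. For time-indexed $Y_t$: $Y_{<t}=\sum_{t'<t}Y_{t'}$, and similarly $Y_{\le t},Y_{>t},Y_{\ge t},Y_{(t,t']},Y_{[t,t']}$. Metrics. $\Delta_{EF}=\max_{t,\theta}|w_\theta(X^{alg}_{t,\theta}-B/N)|$; $\mathrm{Envy}=\max_{t,t'\in[T],\,\theta,\theta'\in\Theta}w_\theta(X^{alg}_{t',\theta'}-X^{alg}_{t,\theta})$; $\Delta_{\mathrm{efficiency}}=B-\sum_{t,\theta}N_{t,\theta}X^{alg}_{t,\theta}$. Forecasts (with $\mathrm{Conf}^N_{t,t}=0$). $\overline N=\mathbb E[N]+\mathrm{Conf}^N_{0,T}$, $\overline N_{>t}=\mathbb E[N_{>t}]+\mathrm{Conf}^N_{t,T}$, $\underline N_{[t,t']}=\mathbb E[N_{[t,t']}]-\mathrm{Conf}^N_{t-1,t'}$, $\underline N_{\le t}=\underline N_{[1,t]}$, $\underline N_{<t}=\underline N_{[1,t-1]}$ ($\underline N_{<1}=0$). For $X\ge0$, $$\tau_b(t\mid X,\sigma)=\inf\{t'\ge t:\underline N_{<t}X+\underline N_{[t,t']}X\ge\sigma(b)\}\ (\inf\emptyset=\infty),\ \text{and for } t=1:\ \tau_b(1\mid X,\sigma)=\inf\{t'\ge1:\underline N_{\le t'}X\ge\sigma(b)\},$$ $$\mu(X)=\sum_{b\in\mathcal B}\Pr(T_b<\min\{T,\tau_b(1\mid X,\sigma)\}),\quad \overline\Delta(X)=\min\{B,\mu(X)+\mathrm{Conf}^P_1(\mu(X))\},$$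 $$\underline X=\sup\{X\mid X\le (B-\overline\Delta(X))/\overline N\}\ \text{(assumed attained)},\quad \mathcal L^{\mathrm{perish}}=B/\overline N-\underline X .$$ $\overline{\mathcal B}_t$ is the set of units of rank at least $\lceil\underline N_{<t}\underline X\rceil$ in $\sigma$, $\eta_t=\sum_{b\in\overline{\mathcal B}_t}\Pr(t\le T_b<\min\{T,\tau_b(t\mid\underline X,\sigma)\})$, $\overline P_0=B$, $\overline P_t=\min\{\overline P_{t-1},\eta_t+\mathrm{Conf}^P_t(\eta_t)\}$. Algorithm Perishing-Guardrail. Set $\overline X=\underline X+L_T$. In each round $t=1,\dots,T$, after observing $N_t$: if $B_t^{alg}<N_t\underline X$, set $X^{alg}_{t,\theta}=B_t^{alg}/N_t$ for all $\theta$; else if $B_t^{alg}-N_t\overline X\ge\underline X\,\overline N_{>t}+\overline P_t$, set $X^{alg}_{t,\theta}=\overline X$ for all $\theta$; else set $X_{t,\theta}^{alg}=\underline X$ for all $\theta$. Allocate the remaining units according to $\sigma$. Notation. $\lesssim$ means that the inequality holds as $T$ grows up to absolute constants and polynomial factors of $\beta_{avg},|\Theta|,w_{max},\mu_{\max},\sigma^2_{\min},\sigma^2_{\max},\rho_{\max},\log T,\log(1/\delta)$. *)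

(* Defs.v *)
(* MathComp / MathComp-Analysis *)
From HB Require Import structures.
From mathcomp Require Import all_boot all_order all_algebra.
From mathcomp Require Import all_classical all_reals all_analysis.

Set Implicit Arguments.
Unset Strict Implicit.
Unset Printing Implicit Defensive.

Import Order.TTheory GRing.Theory Num.Theory.
Import numFieldNormedType.Exports.

Local Open Scope classical_set_scope.
Local Open Scope ring_scope.

Definition mutually_independent d d' (Omega : measurableType d)
    (S : measurableType d') (R : realType) (P : probability Omega R)
    (I : finType) (X : I -> Omega -> S) : Prop :=
  forall (J : {set I}) (A : I -> set S), (forall i, measurable (A i)) ->
    (P (\bigcap_(i in [set` J]) (X i @^-1` A i)) =
     \prod_(i in J) P (X i @^-1` A i))%E.

(* Rounds are the naturals t with 1 <= t <= T; the values of [arrival] and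
   [rho] at other t are never used. *)
Record model (R : realType) (T : nat) := Model {
  disp : measure_display;
  Omega : measurableType disp;
  Pr : probability Omega R;
  Theta : finType;
  Unit : finType;
  w : Theta -> R;
  arrival : nat -> Theta -> {RV Pr >-> nat};
  perish : Unit -> {RV Pr >-> nat};
  rho : nat -> Theta -> R;
  (* the schedule, with ranks counted from 0; see [rank] *)
  schedule : Unit -> 'I_#|Unit|;
  w_gt0 : forall theta, 0 < w theta;
  arrival_ge1 : forall t theta, (1 <= t <= T)%N ->
    {ae Pr, forall o, (1 <= arrival t theta o)%N};
  arrival_integrable : forall t theta, (1 <= t <= T)%N ->
    Pr.-integrable setT (fun o => ((arrival t theta o)%:R : R)%:E);
  arrival_var : forall t theta, (1 <= t <= T)%N ->
    ('V_Pr[fun o => (arrival t theta o)%:R] < +oo)%E;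
  arrival_dev : forall t theta, (1 <= t <= T)%N ->
    {ae Pr, forall o,
      `|(arrival t theta o)%:R - fine 'E_Pr[fun o => (arrival t theta o)%:R]|
        <= rho t theta};
  perish_ge1 : forall b o, (1 <= perish b o)%N;
  independence : mutually_independent Pr
    (fun (i : 'I_T * Theta + Unit) (o : Omega) => match i with
      | inl (s, theta) => arrival s.+1 theta o
      | inr b => perish b o
      end);
  schedule_bij : bijective schedule
}.

Arguments w {R T} m theta.
Arguments arrival {R T} m t theta.
Arguments perish {R T} m b.
Arguments rho {R T} m t theta.
Arguments schedule {R T} m b.

Unset Implicit Arguments.

Section Model.
Context {R : realType} {T : nat} (M : model R T).
Implicit Types (t : nat) (b : Unit M) (o : Omega M) (X : R).

Definition Exp (Y : Omega M -> R) : R := fine ('E_(Pr M)[Y])%E.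

Definition Nreal t (theta : Theta M) o : R := (arrival M t theta o)%:R.
Definition Nround t o : R := \sum_theta Nreal t theta o.
Definition Nbetween t t' o : R := \sum_(t <= s < t'.+1) Nround s o.
Definition Ntotal o : R := Nbetween 1 T o.

Definition B : R := #|Unit M|%:R.
Definition beta_avg : R := B / Exp Ntotal.
Definition rank b : nat := (schedule M b).+1.

(* The quantities maximised below are nonnegative, so 0 is a neutral default;
   likewise every variance is at most [sigma2_max]. *)
Definition w_max : R := \big[Num.max/0]_theta w M theta.
Definition mu_max : R := \big[Num.max/0]_(1 <= t < T.+1) Exp (Nround t).
Definition rho_max : R :=
  \big[Num.max/0]_(1 <= t < T.+1) \big[Num.max/0]_theta rho M t theta.
Definition sigma2 t theta : R := fine ('V_(Pr M)[Nreal t theta])%E.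
Definition sigma2_max : R :=
  \big[Num.max/0]_(1 <= t < T.+1) \big[Num.max/0]_theta sigma2 t theta.
Definition sigma2_min : R :=
  \big[Num.min/sigma2_max]_(1 <= t < T.+1)
    \big[Num.min/sigma2_max]_theta sigma2 t theta.

Section Forecasts.
Context (delta : R).

Definition ConfN t t' : R :=
  Num.sqrt (2 * (t' - t)%N%:R * #|Theta M|%:R * rho_max ^+ 2
            * ln (2 * T%:R ^+ 2 / delta)).

Definition ConfP t (eta : R) : R :=
  let l := ln (3 * t%:R * ln T%:R / delta) in
  (l + Num.sqrt (l ^+ 2 + 8 * eta * l)) / 2.

Definition Nupper : R := Exp Ntotal + ConfN 0 T.
Definition Nupper_after t : R := Exp (Nbetween t.+1 T) + ConfN t T.
Definition Nlower t t' : R := Exp (Nbetween t t') - ConfN t.-1 t'.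
(* equal to 0 at t = 1: empty sum and zero confidence term *)
Definition Nlower_before t : R := Nlower 1 t.-1.

(* The infimum ranges over actual rounds t' <= T; this is harmless since [tau]
   is only used through min(T, tau). At t = 1 the left summand vanishes. *)
Definition tau b t X : \bar R :=
  ereal_inf [set (t'%:R : R)%:E | t' in
    [set t' : nat | (t <= t' <= T)%N /\
       (rank b)%:R <= Nlower_before t * X + Nlower t t' * X]].

Definition perish_prob b t X : R :=
  fine (Pr M [set o | (t <= perish M b o)%N /\
    ((perish M b o)%:R%:E < Order.min (T%:R : R)%:E (tau b t X))%E]).

(* the constraint 1 <= T_b in [perish_prob b 1 X] always holds *)
Definition mu X : R := \sum_b perish_prob b 1 X.

Definition Delta_upper X : R := Num.min B (mu X + ConfP 1 (mu X)).

Definition feasible : set R :=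
  [set X | 0 <= X /\ X <= (B - Delta_upper X) / Nupper].
Definition Xlow : R := sup feasible.
Definition Xlow_attained : Prop := feasible Xlow.

Definition Lperish : R := B / Nupper - Xlow.

Definition late_unit t b : bool :=
  (Num.ceil (Nlower_before t * Xlow) <= (rank b)%:Z).
Definition eta t : R := \sum_(b | late_unit t b) perish_prob b t Xlow.

Fixpoint Pupper t : R :=
  if t is s.+1 then Num.min (Pupper s) (eta t + ConfP t (eta t)) else B.

Section Algorithm.
Context (L : R).

Definition Xhigh : R := Xlow + L.

(* amount per individual in round t, when the current budget is [bud] *)
Definition rule t (bud : R) o : R :=
  if bud < Nround t o * Xlow then bud / Nround t o
  else if Xlow * Nupper_after t + Pupper t <= bud - Nround t o * Xhigh
  then Xhigh else Xlow.

(* [rest b] is the part of unit b neither allocated nor spoiled; a total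
   amount [A] is served greedily along the schedule. *)
Definition unserved (rest : Unit M -> R) (A : R) b : R :=
  rest b - Num.min (rest b)
    (Num.max 0 (A - \sum_(b' | (rank b' < rank b)%N) rest b')).

(* [state t o] is the pair (B_{t+1}, remaining fractions) at the beginning of
   round t.+1 *)
Fixpoint state t o : R * (Unit M -> R) :=
  if t is s.+1 then
    let: (bud, rest) := state s o in
    let A := \sum_theta Nreal t theta o * rule t bud o in
    let rest' := unserved rest A in
    let PUA := \sum_(b | perish M b o == t) rest' b in
    (bud - A - PUA, fun b => if perish M b o == t then 0 else rest' b)
  else (B, fun=> 1).

Definition Balg t o : R := (state t.-1 o).1.
Definition Xalg t (theta : Theta M) o : R := rule t (Balg t o) o.

Definition Delta_EF o : R :=
  \big[Num.max/0]_(1 <= t < T.+1) \big[Num.max/0]_theta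
    `|w M theta * (Xalg t theta o - B / Ntotal o)|.

(* the terms with (t, theta) = (t', theta') are 0, so the default is neutral *)
Definition Envy o : R :=
  \big[Num.max/0]_(1 <= t < T.+1) \big[Num.max/0]_(1 <= t' < T.+1)
  \big[Num.max/0]_theta \big[Num.max/0]_theta'
    (w M theta * (Xalg t' theta' o - Xalg t theta o)).

Definition Delta_efficiency o : R :=
  B - \sum_(1 <= t < T.+1) \sum_theta Nreal t theta o * Xalg t theta o.

End Algorithm.

(* For 0 < delta < 1 all the parameters are nonnegative, so being bounded up to an absolute
   constant and a polynomial in them means being bounded up to
   [C * slack k] for some C and k. *)
Definition slack (k : nat) : R :=
  (1 + beta_avg + #|Theta M|%:R + w_max + mu_max + sigma2_min + sigma2_max
   + rho_max + ln T%:R + ln (1 / delta)) ^+ k.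

End Forecasts.
End Model.

(* Main.v *)
(* Hoeffding's inequality for the arrivals and a Chernoff bound for the units
   perishing before their forecast allocation time show that all forecasts are correct
   with probability at least 1 - 2 delta; the rest is deterministic. When a round [s] is
   served at [Xhigh], the threshold leaves a reserve [Xlow * Nupper_after s + Pupper s],
   enough for serving all later arrivals at [Xlow] despite all later spoilage. Hence
   the budget never falls short of [Xlow], every allocation is [Xlow] or
   [Xlow + L], and the bounds on [Envy] and [Delta_EF] follow.

   For the efficiency, let [s] be the last round served at [Xlow]. As the
   threshold failed there, at most
     N_s L + Xlow * 2 ConfN s T - L (T - s) + 2 Delta_upper
   is wasted. Completing the square bounds the middle terms by O(1/L), while
   [Delta_upper <= Nupper * Lperish] by feasibility of [Xlow]. The square root
   in the statement is thus not needed. *)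
From HB Require Import structures.
From mathcomp Require Import all_boot all_order all_algebra.
From mathcomp Require Import all_classical all_reals all_analysis.
From mathcomp Require Import measurable_realfun ring lra.
Require Import Defs.

Set Implicit Arguments.
Unset Strict Implicit.
Unset Printing Implicit Defensive.

Import Order.TTheory GRing.Theory Num.Theory.
Import numFieldNormedType.Exports.

Local Open Scope classical_set_scope.
Local Open Scope ring_scope.

(** * Exponential inequalities *)

(** The obstacle is a circularity: the budget suffices because spoilage stays below [Pupper], but
    that forecast presumes that all earlier rounds were served at [Xlow] or more. Both facts are
    therefore carried by one induction on rounds. The schedule links them: service is greedy in
    order of rank, so a unit with something left after round u has rank above the total demand up to
    u, hence above [Xlow] times the forecast arrivals; if it spoils then, it is one of the units
    whose early perishing [eta] anticipates. As [Pupper] is a running minimum, the spoilage from a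
    round on must be compared with the forecasts of all earlier rounds too. On the probabilistic
    side, arrivals are almost surely bounded, so they may be replaced by variables with values in a
    finite type, whose exponential moments are finite sums. One delta pays for the windows of
    rounds, at most T^2 of them at delta / T^2 each; the other pays for the spoilage forecasts,
    whose failure probabilities delta / (3 t log T) add up to a harmonic sum. *)

Lemma is_derive1_ge0_ge (R : realType) (f df : R -> R) :
  (forall x : R, is_derive x (1 : R) f (df x)) ->
  (forall x : R, 0 <= x -> 0 <= df x) -> forall x : R, 0 <= x -> f 0 <= f x.
Proof.
move=> fdf df0 x x0.
have [|c cx] := MVT_segment x0 (fun z _ => fdf z).
  apply: continuous_subspaceT => z.
  by apply/differentiable_continuous/derivable1_diffP; have [] := fdf z.
rewrite subr0 => e; rewrite -subr_ge0 e mulr_ge0//; apply: df0.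
by move: cx; rewrite in_itv/= => /andP[].
Qed.

(** On x >= 0 the function 2 cosh x * expR (- x^2 / 2) decreases, because x cosh x >= sinh x there;
    at 0 its value is 2. In the proof [v] is twice the difference of these two sides, and [u] is the
    negated function. *)
Lemma expR_add_expRN_le (R : realType) (x : R) :
  expR x + expR (- x) <= 2 * expR (x ^+ 2 / 2).
Proof.
wlog x0 : x / 0 <= x.
  move=> h; have [/h//|x0] := leP 0 x.
  by rewrite addrC -[in X in _ <= X]sqrrN -[X in _ + expR X]opprK; apply: h; lra.
have v0 y : 0 <= y -> 0 <= (y - 1) * expR y + (1 + y) * expR (- y) :> R.
  move=> y0.
  pose v z : R := (z - 1) * expR z + (1 + z) * expR (- z).
  have -> : 0 = v 0 by rewrite /v oppr0 expR0; ring.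
  apply: (@is_derive1_ge0_ge _ v (fun z => z * expR z - z * expR (- z))) => //.
    move=> z; apply: is_derive_eq.
    by rewrite /= /GRing.scale/=; ring.
  move=> z z0; rewrite -mulrBr mulr_ge0// subr_ge0 ler_expR; lra.
pose u z : R := - (expR (z - z ^+ 2 / 2) + expR (- z - z ^+ 2 / 2)).
have : u 0 <= u x.
  apply: (@is_derive1_ge0_ge _ u
    (fun z => expR (- (z ^+ 2 / 2)) * ((z - 1) * expR z + (1 + z) * expR (- z)))) => //.
    move=> z; apply: is_derive_eq.
    by rewrite /= /GRing.scale/= !expRD; field.
  by move=> z z0; rewrite mulr_ge0 ?expR_ge0 ?v0.
rewrite /u expr0n/= mul0r !subr0 oppr0 expR0 lerN2 !expRD -mulrDl => h.
have e0 := expR_gt0 (x ^+ 2 / 2).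
by move: h; rewrite (expRN (x ^+ 2 / 2)) ler_pdivrMr.
Qed.

Lemma expR_chord (R : realType) (l r y : R) : 0 < r -> `|y| <= r ->
  expR (l * y) <= ((r + y) * expR (l * r) + (r - y) * expR (- (l * r))) / (2 * r).
Proof.
move=> r0; rewrite ler_norml => /andP[ry yr].
have t0 : 0 <= (r + y) / (2 * r) by rewrite divr_ge0//; lra.
have t1 : (r + y) / (2 * r) <= 1 by rewrite ler_pdivrMr; lra.
have := convex_expR (Itv01 t0 t1) (l * r) (- (l * r)).
rewrite !convRE/= /unstable.onem.
have -> : (r + y) / (2 * r) * (l * r) + (1 - (r + y) / (2 * r)) * - (l * r) =
  l * y by field; lra.
by move=> /le_trans; apply; rewrite le_eqVlt; apply/orP; left; apply/eqP; field; lra.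
Qed.

(** Convexity bounds each exponential by its chord over [-r, r]. Since the mean is zero, averaging
    the chords leaves only cosh (l * r). *)
Lemma hoeffding_lemma (R : realType) (I : finType) (p y : I -> R) (l r : R) :
  0 < r -> (forall i, 0 <= p i) -> \sum_i p i = 1 -> \sum_i p i * y i = 0 ->
  (forall i, p i != 0 -> `|y i| <= r) ->
  \sum_i p i * expR (l * y i) <= expR ((l * r) ^+ 2 / 2).
Proof.
move=> r0 p0 p1 py yr; set a := l * r.
apply: (@le_trans _ _ (\sum_i p i * (((r + y i) * expR a
    + (r - y i) * expR (- a)) / (2 * r)))).
  apply: ler_sum => i _; have [->|pi0] := eqVneq (p i) 0; first by rewrite !mul0r.
  by rewrite ler_wpM2l// expR_chord// yr.
have -> : \sum_i p i * (((r + y i) * expR a + (r - y i) * expR (- a)) / (2 * r)) =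
    (expR a + expR (- a)) / 2 * (\sum_i p i)
    + (expR a - expR (- a)) / (2 * r) * (\sum_i p i * y i).
  rewrite !mulr_sumr -big_split/=; apply: eq_bigr => i _; field; lra.
rewrite py p1 mulr0 addr0 mulr1 ler_pdivrMr// mulrC.
exact: expR_add_expRN_le.
Qed.

(** The difference of the two sides vanishes at 0 and has derivative 1 - (1 - z) expR z, which is
    nonnegative because expR (- z) >= 1 - z. *)
Lemma expR_pade (R : realType) (x : R) : 0 <= x -> (2 - x) * expR x <= 2 + x.
Proof.
move=> x0; rewrite -subr_ge0.
pose f z : R := 2 + z - (2 - z) * expR z.
have -> : 0 = f 0 by rewrite /f expR0; ring.
apply: (@is_derive1_ge0_ge _ f (fun z => 1 - (1 - z) * expR z)) => //.
  by move=> z; apply: is_derive_eq; rewrite /= /GRing.scale/=; ring.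
move=> z _; rewrite subr_ge0 -ler_pdivlMr ?expR_gt0// mul1r -expRN.
exact: expR_ge1Dx.
Qed.

(* For a sum [S] of independent Bernoulli variables of mean [e], the left-hand side
   bounds the logarithm of [E expR (l * (S - e - c))]. At [l = 2 * c / (2 * e + c)] the
   Pade bound on [expR l] makes it the right-hand side. *)
Lemma bernoulli_exponent_le (R : realType) (e c : R) : 0 <= e -> 0 < c ->
  exists2 l : R, 0 <= l & e * (expR l - 1) - l * (e + c) <= - (c ^+ 2 / (2 * e + c)).
Proof.
move=> e0 c0; have d0 : 0 < 2 * e + c by lra.
move: e0; rewrite le_eqVlt => /predU1P[<-|e0].
  (* The general witness leads to a division by e; at e = 0 any l >= 1 will do. *)
  by exists 1 => //; rewrite le_eqVlt; apply/orP; left; apply/eqP; field; lra.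
exists (2 * c / (2 * e + c)); first by rewrite divr_ge0//; lra.
set l := _ / _.
have := @expR_pade _ l; rewrite divr_ge0 ?(ltW d0)// ?mulr_ge0 ?(ltW c0)// => /(_ isT).
have -> : 2 - l = 4 * e / (2 * e + c) by rewrite /l; field; lra.
have -> : 2 + l = (4 * e / (2 * e + c)) * ((e + c) / e) by rewrite /l; field; lra.
rewrite ler_pM2l; last by rewrite divr_gt0//; lra.
move=> h; apply: (@le_trans _ _ (e * ((e + c) / e - 1) - l * (e + c))).
  by rewrite lerD2r ler_wpM2l ?(ltW e0)// lerD2r.
by rewrite le_eqVlt; apply/orP; left; apply/eqP; rewrite /l; field; lra.
Qed.

(** Each new term satisfies 1 / (n + 2) <= ln ((n + 2) / (n + 1)), which is ln (1 + x) <= x at x = -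
    1 / (n + 2). *)
Lemma harmonic_le_ln (R : realType) (n : nat) :
  \sum_(1 <= t < n.+2) t%:R^-1 <= 1 + ln n.+1%:R :> R.
Proof.
elim: n => [|n ih]; first by rewrite big_nat1 invr1 ln1 addr0.
rewrite big_nat_recr//=.
have h : (n.+2%:R : R)^-1 <= ln n.+2%:R - ln n.+1%:R.
  have := @le_ln1Dx R (- n.+2%:R^-1); rewrite ltrN2 invf_lt1 ?ltr1n ?ltr0n// => /(_ isT).
  have -> : 1 + - n.+2%:R^-1 = n.+1%:R / n.+2%:R :> R.
    have a0 : 0 < n.+1%:R :> R by rewrite ltr0n.
    by rewrite -(natr1 n.+1); move: a0; set a := n.+1%:R => a0; field; lra.
  rewrite ln_div ?posrE ?ltr0n//; move: (ln _) (ln _) => a b h.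
  by rewrite -[leRHS]opprB lerNr.
by rewrite (le_trans (lerD ih h))// -addrA addrCA addrC addrA subrK addrC.
Qed.

(** * Tail bounds for independent finite-valued variables *)

Section finite_valued_variables.
Context d (Om : measurableType d) (R : realType) (P : probability Om R).
Implicit Types (A : set Om) (F I : finType).

(** Finitely many natural-valued variables have countably many joint values, so a set that they
    determine is a countable union of their joint fibres. Measurability thus reduces to checking
    what a set depends on. *)
Lemma measurable_of_nat_family I (X : I -> Om -> nat) A :
  (forall i, measurable_fun setT (X i)) ->
  (forall o o', (forall i, X i o = X i o') -> A o -> A o') -> measurable A.
Proof.
move=> mX XA.
pose G (x : {ffun I -> nat}) : set Om :=
  [set o | A o] `&` [set o | forall i, X i o = x i].
have -> : A = \bigcup_x G x.
  apply/seteqP; split=> [ o Ao|o [x _ [] //]].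
  by exists [ffun i => X i o] => //; split => //= i; rewrite ffunE.
apply: countable_bigcupT_measurable; first exact: countableP.
move=> x; have [[ o [Ao ox]]|G0] := pselect (exists o, G x o); last first.
  rewrite (_ : G x = set0)//; apply/seteqP; split => // o Go.
  by apply: G0; exists o.
rewrite (_ : G x = \bigcap_(i in [set: I]) (X i @^-1` [set x i])).
  apply: fin_bigcap_measurable; first exact: finite_finset.
  by move=> i _; rewrite -[X in measurable X]setTI; exact: mX.
apply/seteqP; split => [ o' [_ o'x] i _|o' o'x]; first exact: o'x.
split; last by move=> i; exact: o'x.
by apply: XA Ao => i; rewrite ox o'x.
Qed.

Definition prob A : R := fine (P A).

Lemma probE A : measurable A -> P A = (prob A)%:E.
Proof. by move=> mA; rewrite fineK// fin_num_measure. Qed.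

Lemma prob_ge0 A : 0 <= prob A.
Proof. by rewrite fine_ge0. Qed.

Lemma prob0 : prob set0 = 0.
Proof. by rewrite /prob measure0. Qed.

Lemma probU_le A1 A2 : measurable A1 -> measurable A2 ->
  prob (A1 `|` A2) <= prob A1 + prob A2.
Proof.
move=> m1 m2; rewrite -lee_fin EFinD -!probE//; last exact: measurableU.
exact: measureU2.
Qed.

Lemma le_prob A1 A2 : measurable A1 -> measurable A2 -> A1 `<=` A2 ->
  prob A1 <= prob A2.
Proof.
by move=> m1 m2 A12; rewrite -lee_fin -!probE//; apply: le_measure; rewrite ?inE.
Qed.

Lemma prob_le_sum I A (A_ : I -> set Om) : measurable A ->
  (forall i, measurable (A_ i)) -> (forall o, A o -> exists i, A_ i o) ->
  prob A <= \sum_i prob (A_ i).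
Proof.
move=> mA mA_ sA; apply: (@le_trans _ _ (prob (\big[setU/set0]_i A_ i))).
  apply: le_prob => // [|o /sA[i Aio]]; first exact: bigsetU_measurable.
  by rewrite -bigcup_seq; exists i => //=; rewrite mem_index_enum.
elim: (index_enum I) => [|i s ih]; first by rewrite !big_nil prob0.
rewrite !big_cons (le_trans (probU_le _ _))// ?lerD2l//.
exact: bigsetU_measurable.
Qed.

Lemma measurable_preimage_finite F (Z : Om -> F) (B : set F) :
  (forall x, measurable (Z @^-1` [set x])) -> measurable (Z @^-1` B).
Proof.
move=> mZ; rewrite (_ : Z @^-1` B = \bigcup_(x in B) Z @^-1` [set x]).
  by apply: fin_bigcup_measurable => //; exact: finite_finset.
by apply/seteqP; split=> [ o Bo|o [x Bx /= ->]//]; exists (Z o).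
Qed.

Lemma prob_preimage_seq F (Z : Om -> F) (s : seq F) :
  (forall x, measurable (Z @^-1` [set x])) -> uniq s ->
  prob [set o | Z o \in s] = \sum_(x <- s) prob (Z @^-1` [set x]).
Proof.
move=> mZ; elim: s => [_|x s ih /= /andP[xs us]].
  by rewrite big_nil -prob0; congr prob; apply/seteqP; split.
have -> : [set o | Z o \in x :: s] = Z @^-1` [set x] `|` [set o | Z o \in s].
  apply/seteqP; split => o /=; rewrite inE.
    by case/orP => [/eqP|]; [left|right].
  by case => [->|->]; rewrite ?eqxx ?orbT.
have ms : measurable [set o | Z o \in s].
  exact: (measurable_preimage_finite (fun x => x \in s)).
rewrite big_cons -ih// /prob measureU//; first by rewrite fineD// fin_num_measure.
apply/seteqP; split => // o /= [Zx]; rewrite Zx => xs'.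
by rewrite xs' in xs.
Qed.

Lemma prob_preimage F (Z : Om -> F) (B : pred F) :
  (forall x, measurable (Z @^-1` [set x])) ->
  prob [set o | B (Z o)] = \sum_(x | B x) prob (Z @^-1` [set x]).
Proof.
move=> mZ; rewrite -big_enum/= -(prob_preimage_seq mZ (enum_uniq B)).
by congr prob; apply/seteqP; split => o /=; rewrite mem_enum.
Qed.

Lemma sum_prob_preimage F (Z : Om -> F) :
  (forall x, measurable (Z @^-1` [set x])) ->
  \sum_x prob (Z @^-1` [set x]) = 1.
Proof.
move=> mZ; have <- := prob_preimage predT mZ.
by rewrite (_ : [set o | _] = setT) /prob ?probability_setT//; exact/seteqP.
Qed.

Lemma expectation_finite F (Z : Om -> F) (f : F -> R) :
  (forall x, measurable (Z @^-1` [set x])) -> (forall x, 0 <= f x) ->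
  ('E_P[f \o Z] = (\sum_x prob (Z @^-1` [set x]) * f x)%:E)%E.
Proof.
move=> mZ f0; rewrite expectation.unlock.
under eq_integral => o _.
  rewrite (_ : (f \o Z) o = \sum_x f x * \1_(Z @^-1` [set x]) o); last first.
    rewrite (bigD1 (Z o))//= indicE mem_set// mulr1 big1 ?addr0// => x xo.
    by rewrite indicE memNset ?mulr0//= => Zx; rewrite Zx eqxx in xo.
  rewrite -sumEFin; over.
rewrite ge0_integral_sum//.
- rewrite -sumEFin; apply: eq_bigr => x _.
  rewrite (integralZl_indic measurableT (fun=> Z @^-1` [set x]))//;
    last by move=> fx; have := f0 x; rewrite leNgt fx.
  by rewrite integral_indic// setIT EFinM fineK ?fin_num_measure// muleC.
- move=> x; apply/measurable_EFinP; apply: measurable_funM => //.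
- by move=> x o _; rewrite lee_fin mulr_ge0// indicE.
Qed.

(** * Exponential tail bounds for independent families *)

Section chernoff.
Context I F (Z : I -> Om -> F).
Hypothesis mZ : forall i x, measurable (Z i @^-1` [set x]).
Hypothesis indepZ : forall x : I -> F,
  prob [set o | forall i, Z i o = x i] = \prod_i prob (Z i @^-1` [set x i]).

Lemma measurable_of_finite_family A :
  (forall o o', (forall i, Z i o = Z i o') -> A o -> A o') -> measurable A.
Proof.
move=> ZA; pose Y o := [ffun i => Z i o].
have mY (x : {ffun I -> F}) : measurable (Y @^-1` [set x]).
  rewrite (_ : _ @^-1` _ = \bigcap_(i in [set: I]) (Z i @^-1` [set x i])).
    by apply: fin_bigcap_measurable; first exact: finite_finset.
  apply/seteqP; split => [ o /= <- i _|o Zx /=]; first by rewrite /= ffunE.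
  by apply/ffunP => i; rewrite ffunE; exact: Zx.
rewrite (_ : A = Y @^-1` [set x | exists2 o, A o & Y o = x]).
  exact: measurable_preimage_finite.
apply/seteqP; split=> [ o Ao|o [ o' Ao' Yo']]; first by exists o.
by apply: ZA Ao' => i; move/ffunP: Yo' => /(_ i); rewrite !ffunE.
Qed.

(** Markov's inequality in finite form: distributing the product of sums gives one term per joint
    value x, equal to the probability of x times expR (l * (\sum_i g i (x i) - a)). The exponential
    factor is at least 1 on the event, and the remaining terms are nonnegative. *)
Lemma chernoff_indep (g : I -> F -> R) (l a : R) : 0 <= l ->
  prob [set o | a <= \sum_i g i (Z i o)] <=
  expR (- (l * a)) * \prod_i \sum_x prob (Z i @^-1` [set x]) * expR (l * g i x).
Proof.
move=> l0; pose Y o := [ffun i => Z i o].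
have EY (x : {ffun I -> F}) : Y @^-1` [set x] = [set o | forall i, Z i o = x i].
  apply/seteqP; split => [ o /= <- i|o Zx /=]; first by rewrite ffunE.
  by apply/ffunP => i; rewrite ffunE.
have mY (x : {ffun I -> F}) : measurable (Y @^-1` [set x]).
  by apply: measurable_of_finite_family => o o' eqoo; rewrite EY /= => h i; rewrite -eqoo h.
have := prob_preimage (fun x : {ffun I -> F} => a <= \sum_i g i (x i)) mY.
rewrite (_ : [set o | _] = [set o | a <= \sum_i g i (Z i o)]); last first.
  by apply: eq_set => o; congr (is_true (a <= _)); apply: eq_bigr => i _; rewrite ffunE.
move=> ->; rewrite bigA_distr_bigA/= mulr_sumr.
rewrite big_mkcond; apply: ler_sum => x _.
have e0 : 0 <= expR (- (l * a)) *
    \prod_i (prob (Z i @^-1` [set x i]) * expR (l * g i (x i))).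
  by rewrite mulr_ge0 ?expR_ge0// prodr_ge0// => i _; rewrite mulr_ge0 ?expR_ge0 ?prob_ge0.
case: ifPn => // ax.
rewrite EY indepZ big_split/= mulrCA ler_peMr//.
  by rewrite prodr_ge0// => i _; exact: prob_ge0.
rewrite -expR_sum -expRD -mulr_sumr addrC -mulrBr.
by rewrite -[leLHS]expR0 ler_expR mulr_ge0// subr_ge0.
Qed.

(** With a the threshold, l = a / (#|J| r^2) minimises - l a + #|J| (l r)^2 / 2; the minimum - a^2 /
    (2 #|J| r^2) is - c by the choice of a. Indices outside J are given the value 0 and contribute a
    factor 1. *)
Lemma hoeffding_upper (g : I -> F -> R) (J : {set I}) (r c : R) :
  0 < r -> 0 <= c -> (0 < #|J|)%N ->
  (forall i, i \in J -> \sum_x prob (Z i @^-1` [set x]) * g i x = 0) ->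
  (forall i x, i \in J -> prob (Z i @^-1` [set x]) != 0 -> `|g i x| <= r) ->
  prob [set o | Num.sqrt (2 * #|J|%:R * r ^+ 2 * c) <= \sum_(i in J) g i (Z i o)]
    <= expR (- c).
Proof.
move=> r0 c0 J0 g0 gr; set a := Num.sqrt _.
have a2 : a ^+ 2 = 2 * #|J|%:R * r ^+ 2 * c.
  by rewrite sqr_sqrtr// !mulr_ge0// ?(ltW r0).
have J0' : 0 < #|J|%:R :> R by rewrite ltr0n.
have l0 : 0 <= a / (#|J|%:R * r ^+ 2).
  by rewrite divr_ge0 ?sqrtr_ge0// mulr_ge0// ?sqr_ge0.
set l := a / _ in l0 *.
have := chernoff_indep (fun i x => if i \in J then g i x else 0) a l0.
under eq_set do rewrite -big_mkcond/=.
move/le_trans; apply.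
have p1 i := sum_prob_preimage (mZ i).
apply: (@le_trans _ _ (expR (- (l * a)) * \prod_(i in J) expR ((l * r) ^+ 2 / 2))).
  rewrite ler_wpM2l ?expR_ge0// [leRHS]big_mkcond; apply: ler_prod => i _.
  rewrite sumr_ge0/=; last by move=> x _; rewrite mulr_ge0 ?expR_ge0 ?prob_ge0.
  case: ifPn => iJ; last first.
    by under eq_bigr do rewrite mulr0 expR0 mulr1; rewrite p1.
  by apply: hoeffding_lemma => //;
    [move=> x; exact: prob_ge0|exact: g0|move=> x; exact: gr].
rewrite prodr_const -expRM_natl -expRD ler_expR le_eqVlt; apply/orP; left; apply/eqP.
transitivity (- (a ^+ 2 / (2 * #|J|%:R * r ^+ 2))).
  by rewrite /l; field; rewrite !gt_eqF.
by rewrite a2; field; rewrite !gt_eqF.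
Qed.

Lemma hoeffding (g : I -> F -> R) (J : {set I}) (r c : R) :
  0 < r -> 0 <= c -> (0 < #|J|)%N ->
  (forall i, i \in J -> \sum_x prob (Z i @^-1` [set x]) * g i x = 0) ->
  (forall i x, i \in J -> prob (Z i @^-1` [set x]) != 0 -> `|g i x| <= r) ->
  prob [set o | Num.sqrt (2 * #|J|%:R * r ^+ 2 * c) <= `|\sum_(i in J) g i (Z i o)| ]
    <= 2 * expR (- c).
Proof.
move=> r0 c0 J0 g0 gr; set a := Num.sqrt _.
have mA (h : (I -> F) -> Prop) : measurable [set o | h (Z^~ o)].
  apply: measurable_of_finite_family => o o' eqoo /=.
  by rewrite (_ : Z^~ o = Z^~ o')//; apply/funext.
apply: (@le_trans _ _ (prob ([set o | a <= \sum_(i in J) g i (Z i o)] `|`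
    [set o | a <= \sum_(i in J) - g i (Z i o)]))).
  apply: le_prob.
  - exact: (mA (fun z => a <= `|\sum_(i in J) g i (z i)|)).
  - apply: measurableU; first exact: (mA (fun z => a <= \sum_(i in J) g i (z i))).
    exact: (mA (fun z => a <= \sum_(i in J) - g i (z i))).
  - by move=> o /=; rewrite sumrN ler_normr => /orP.
apply: (le_trans (probU_le _ _)).
- exact: (mA (fun z => a <= \sum_(i in J) g i (z i))).
- exact: (mA (fun z => a <= \sum_(i in J) - g i (z i))).
rewrite mulr_natl mulr2n lerD//; first exact: hoeffding_upper.
apply: (@hoeffding_upper (fun i x => - g i x)) => //.
  by move=> i iJ; under eq_bigr do rewrite mulrN; rewrite sumrN g0// oppr0.
by move=> i x iJ px; rewrite normrN gr.
Qed.

End chernoff.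

(** A Bernoulli variable of mean p has exponential moment 1 + p (expR l - 1) <= expR (p (expR l -
    1)), so the product over i depends on the means only through their sum e. *)
Lemma chernoff_bernoulli I (Z : I -> Om -> bool) (c e : R) :
  (forall i x, measurable (Z i @^-1` [set x])) ->
  (forall x : I -> bool,
    prob [set o | forall i, Z i o = x i] = \prod_i prob (Z i @^-1` [set x i])) ->
  e = \sum_i prob [set o | Z i o] -> 0 < c ->
  prob [set o | e + c <= \sum_i (Z i o)%:R] <= expR (- (c ^+ 2 / (2 * e + c))).
Proof.
move=> mZ iZ eE c0.
have e0 : 0 <= e by rewrite eE sumr_ge0// => i _; exact: prob_ge0.
have [l l0 le] := bernoulli_exponent_le e0 c0.
apply: le_trans (chernoff_indep mZ iZ (fun _ x => x%:R) (e + c) l0) _.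
apply: (@le_trans _ _ (expR (- (l * (e + c))) * expR (e * (expR l - 1)))); last first.
  by rewrite -expRD ler_expR addrC.
rewrite ler_wpM2l ?expR_ge0// {1}eE mulr_suml expR_sum; apply: ler_prod => i _.
rewrite sumr_ge0/=; last by move=> x _; rewrite mulr_ge0 ?expR_ge0 ?prob_ge0.
have := sum_prob_preimage (mZ i); rewrite !big_bool/=.
rewrite mulr0 expR0 !mulr1.
rewrite (_ : Z i @^-1` [set true] = [set o | Z i o])// => p1.
apply: le_trans (expR_ge1Dx _); rewrite mulrBr mulr1; lra.
Qed.

End finite_valued_variables.

(** * Serving demand along the schedule *)

Section greedy.
Context (R : realType) (T : nat) (M : model R T).
Implicit Types (b : Unit M) (rest F : Unit M -> R) (A : R).

Lemma rank_inj : injective (rank M).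
Proof. by move=> b b' [/val_inj]; exact: (bij_inj (schedule_bij M)). Qed.

Lemma sum_rank_leS F n : \sum_(b | (rank M b <= n.+1)%N) F b =
  \sum_(b | (rank M b <= n)%N) F b + \sum_(b | rank M b == n.+1) F b.
Proof.
rewrite (bigID (fun b => rank M b <= n)%N)/=; congr (_ + _); apply: eq_bigl => b.
  by apply/andP/idP => [[]//|h]; split => //; exact: leqW.
by rewrite -ltnNge -eqn_leq.
Qed.

Lemma sum_rank_eq F b : \sum_(b' | rank M b' == rank M b) F b' = F b.
Proof. by under eq_bigl do rewrite (inj_eq rank_inj); rewrite big_pred1_eq. Qed.

Lemma card_rank_le n : \sum_(b | (rank M b <= n)%N) (1 : R) <= n%:R.
Proof.
elim: n => [|n ih]; first by rewrite big_pred0.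
rewrite sum_rank_leS -natr1 lerD//.
case: (pickP (fun b => rank M b == n.+1)) => [b /eqP <-|h].
  by rewrite sum_rank_eq.
by rewrite big_pred0.
Qed.

(** Greedy service in closed form: every initial segment of the schedule gives up as much as it
    holds or all of A, whichever is less. The induction runs over all n, including those that are
    not a rank. *)
Lemma sum_served_prefix rest A n : (forall b, 0 <= rest b) -> 0 <= A ->
  \sum_(b | (rank M b <= n)%N) (rest b - unserved M rest A b) =
  Num.min A (\sum_(b | (rank M b <= n)%N) rest b).
Proof.
move=> r0 A0; elim: n => [|n ih]; first by rewrite !big_pred0//; case: leP => //; lra.
rewrite !sum_rank_leS ih.
case: (pickP (fun b => rank M b == n.+1)) => [b /eqP bn|h]; last first.
  by rewrite !(big_pred0 _ _ _ _ h) !addr0.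
have E : \sum_(b' | (rank M b' < rank M b)%N) rest b' =
  \sum_(b' | (rank M b' <= n)%N) rest b' by rewrite bn.
rewrite -bn !sum_rank_eq /unserved E.
have := r0 b; move: (rest b) (\sum_(_ | _) _) => r S r0'.
by rewrite subKr; case: (leP A S) => ?; case: (leP A (S + r)) => ?;
   case: (leP 0 (A - S)) => ?; case: (leP r _) => ?; lra.
Qed.

Lemma sum_served rest A : (forall b, 0 <= rest b) -> 0 <= A <= \sum_b rest b ->
  \sum_b (rest b - unserved M rest A b) = A.
Proof.
move=> r0 /andP[A0 Ar]; have all F : \sum_b F b = \sum_(b | (rank M b <= #|Unit M|)%N) F b.
  by apply: eq_bigl => b; rewrite /rank ltn_ord.
by rewrite all sum_served_prefix// -all; apply/min_idPl.
Qed.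

Lemma unserved_le rest A b : (forall b, 0 <= rest b) ->
  0 <= unserved M rest A b <= rest b.
Proof.
by move=> r0; rewrite /unserved; have := r0 b; case: (leP 0 (A - _)) => ?;
  case: (leP (rest b) _) => ? ?; apply/andP; split; lra.
Qed.

(** If b is not exhausted, the demand has stopped at b or before it, so the segment up to b has met
    all of A. *)
Lemma unserved_gt0 rest A b : (forall b, 0 <= rest b) -> 0 <= A ->
  0 < unserved M rest A b ->
  \sum_(b' | (rank M b' <= rank M b)%N) (rest b' - unserved M rest A b') = A.
Proof.
move=> r0 A0 u0; rewrite sum_served_prefix//; apply/min_idPl.
rewrite /rank sum_rank_leS -/(rank M b) sum_rank_eq.
move: u0; rewrite /unserved.
rewrite (_ : \sum_(b' | (rank M b' < rank M b)%N) rest b' =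
  \sum_(b' | (rank M b' <= schedule M b)%N) rest b')//.
have := r0 b; move: (rest b) (\sum_(_ | _) _) => r S r0'.
by case: (leP 0 (A - S)) => ?; case: (leP r _) => ? ?; lra.
Qed.

End greedy.

(** * Budget and remaining units along one run *)

Section run.
Context (R : realType) (T : nat) (M : model R T) (delta L : R) (o : Omega M).
Implicit Types (b : Unit M) (t s : nat).

Let bud t : R := (state M delta L t o).1.
Let rest t := (state M delta L t o).2.

Definition alg_amount t : R := rule M delta L t (Balg M delta L t o) o.
Definition round_demand t : R := Nround M t o * alg_amount t.
(** The fractions between the service of round t and the spoilage at its end. *)
Definition leftover t := unserved M (state M delta L t.-1 o).2 (round_demand t).
Definition perished_amount t : R := \sum_(b | perish M b o == t) leftover t b.
Definition total_demand t : R := \sum_(1 <= s < t.+1) round_demand s.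

Lemma demandE t : \sum_theta Nreal M t theta o * alg_amount t = round_demand t.
Proof. by rewrite -mulr_suml. Qed.

Lemma stateS t : state M delta L t.+1 o =
  (Balg M delta L t.+1 o - round_demand t.+1 - perished_amount t.+1,
   fun b => if perish M b o == t.+1 then 0 else leftover t.+1 b).
Proof.
rewrite /perished_amount /leftover -demandE /alg_amount /Balg /=.
by case: (state M delta L t o).
Qed.

Lemma BalgS t : (0 < t)%N ->
  Balg M delta L t.+1 o = Balg M delta L t o - round_demand t - perished_amount t.
Proof. by case: t => // t _; rewrite {1}/Balg/= -/(state M delta L t.+1 o) stateS. Qed.

(** Under this condition the greedy service hands out exactly the demand of each round, so that the
    budget stays equal to the sum of the remaining fractions. *)
Definition affordable t := forall s, (1 <= s <= t)%N ->
  0 <= round_demand s <= Balg M delta L s o.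

Lemma affordableW t t' : (t <= t')%N -> affordable t' -> affordable t.
Proof.
by move=> tt' h s /andP[s1 st]; apply: h; rewrite s1 (leq_trans st).
Qed.

Lemma demand_uptoS t : total_demand t.+1 = total_demand t + round_demand t.+1.
Proof. by rewrite /total_demand big_nat_recr. Qed.

(* Units up to that of rank [rank b] have together lost at least the demand so far as
   long as [b] itself is not exhausted: round_demand is served in order of rank. *)
Definition run_invariant t :=
  [/\ bud t = \sum_b rest t b, forall b, 0 <= rest t b <= 1 &
    forall b, 0 < rest t b ->
      total_demand t <= \sum_(b' | (rank M b' <= rank M b)%N) (1 - rest t b')].

Lemma run_step t : run_invariant t -> affordable t.+1 ->
  [/\ \sum_b leftover t.+1 b = bud t - round_demand t.+1,
    forall b, 0 <= leftover t.+1 b <= rest t b &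
    forall b, 0 < leftover t.+1 b ->
      total_demand t.+1 <= \sum_(b' | (rank M b' <= rank M b)%N) (1 - leftover t.+1 b')].
Proof.
move=> [bE r01 rgt] /(_ t.+1); rewrite ltnS leqnn => /(_ isT).
change (Balg M delta L t.+1 o) with (bud t); rewrite bE => Dle; have /andP[D0 _] := Dle.
have r0 b : 0 <= rest t b by have /andP[] := r01 b.
have l0 b : 0 <= leftover t.+1 b <= rest t b by exact: unserved_le.
split => //.
  have := sum_served r0 Dle; rewrite sumrB => <-.
  by rewrite opprB addrC subrK.
move=> b lb; have /andP[_ lr] := l0 b.
rewrite demand_uptoS -(unserved_gt0 r0 D0 lb).
apply: (le_trans (lerD (rgt b (lt_le_trans lb lr)) (lexx _))).
by rewrite -big_split/=; apply: ler_sum => b' _; rewrite /leftover/=; lra.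
Qed.

Lemma run_invariantP t : affordable t -> run_invariant t.
Proof.
elim: t => [_|t ih h].
  split => [|b|b _]; rewrite /rest /bud/=.
  - by rewrite sumr_const.
  - by rewrite ler01 lexx.
  - by rewrite /total_demand big_nil subrr big1.
have inv := ih (affordableW (leqnSn t) h).
have [lE l01 lgt] := run_step inv h; have [_ r01 _] := inv.
have rl b : rest t.+1 b <= leftover t.+1 b.
  by rewrite /rest stateS/=; case: ifP => // _; have /andP[] := l01 b.
split.
- rewrite /bud /rest stateS/= -/(bud t) -lE /perished_amount.
  rewrite (bigID (fun b => perish M b o == t.+1))/= addrAC subrr add0r big_mkcond/=.
  by apply: eq_bigr => b _; case: eqP.
- move=> b; have /andP[l0 lr] := l01 b; have /andP[_ r1] := r01 b.
  rewrite (le_trans (rl b) (le_trans lr r1)) andbT.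
  by rewrite /rest stateS/=; case: ifP.
- move=> b rb; apply: (le_trans (lgt b (lt_le_trans rb (rl b)))).
  by apply: ler_sum => b' _; rewrite lerD2l lerN2.
Qed.

Lemma leftover_ge0 t b : affordable t.+1 -> 0 <= leftover t.+1 b <= 1.
Proof.
move=> h; have inv := run_invariantP (affordableW (leqnSn t) h).
have [_ l01 _] := run_step inv h; have [_ r01 _] := inv.
by have /andP[-> lr] := l01 b; have /andP[_ /(le_trans lr)] := r01 b.
Qed.

(** The units up to b have lost at least the total demand. Each of them can lose at most 1, and b
    has lost strictly less, whence the strict inequality. *)
Lemma leftover_rank t b : affordable t.+1 -> 0 < leftover t.+1 b ->
  total_demand t.+1 < (rank M b)%:R.
Proof.
move=> h l0; have inv := run_invariantP (affordableW (leqnSn t) h).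
have [_ _ /(_ b l0)/le_lt_trans] := run_step inv h; apply.
rewrite /rank sum_rank_leS -/(rank M b) sum_rank_eq -natr1 ler_ltD//; last first.
  by rewrite ltrBlDr ltrDl.
apply: le_trans (card_rank_le M _); apply: ler_sum => b' _.
by rewrite lerBlDr lerDl; have /andP[] := leftover_ge0 b' h.
Qed.

Lemma spoiled_ge0 t : affordable t.+1 -> 0 <= perished_amount t.+1.
Proof. by move=> h; apply: sumr_ge0 => b _; have /andP[] := leftover_ge0 b h. Qed.

(** This removes the state of the run from the estimate: what spoils is bounded by a count of units
    in terms of perishing times and total demand alone. *)
Lemma spoiled_le t : affordable t.+1 ->
  perished_amount t.+1 <= \sum_b ((perish M b o == t.+1) && (total_demand t.+1 < (rank M b)%:R))%:R.
Proof.
move=> h; rewrite /perished_amount big_mkcond; apply: ler_sum => b _; case: ifP => //= _.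
have /andP[l0 l1] := leftover_ge0 b h.
move: l0; rewrite le_eqVlt => /predU1P[<-|l0]; first by rewrite ler0n.
by rewrite (leftover_rank h l0).
Qed.

Lemma budget_conservation t : Balg M delta L t.+1 o =
  B M - total_demand t - \sum_(1 <= s < t.+1) perished_amount s.
Proof.
elim: t => [|t ih]; first by rewrite /total_demand !big_nil !subr0.
by rewrite BalgS// ih demand_uptoS (@big_nat_recr _ _ _ t.+1)//=; ring.
Qed.

End run.

(** * Forecasts *)

Section expectation_of_arrivals.
Context (R : realType) (T : nat) (M : model R T).
Implicit Types (t s : nat).

Lemma Exp_sum I (r : seq I) (p : pred I) (F : I -> Omega M -> R) :
  (forall i, p i -> (Pr M).-integrable setT (EFin \o F i)) ->
  Exp M (fun o => \sum_(i <- r | p i) F i o) = \sum_(i <- r | p i) Exp M (F i) /\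
  (Pr M).-integrable setT (EFin \o (fun o => \sum_(i <- r | p i) F i o)).
Proof.
move=> iF; elim: r => [|i r [ih1 ih2]].
  rewrite big_nil (_ : (fun o => _) = cst 0); last by apply/funext => o; rewrite big_nil.
  by split; [rewrite /Exp expectation_cst|exact: integrable0].
rewrite big_cons; case: ifPn => pi; last first.
  have -> : (fun o => \sum_(j <- i :: r | p j) F j o) =
      (fun o => \sum_(j <- r | p j) F j o).
    by apply/funext => o; rewrite big_cons (negbTE pi).
  by split.
have -> : (fun o => \sum_(j <- i :: r | p j) F j o) =
    (fun o => F i o + \sum_(j <- r | p j) F j o).
  by apply/funext => o; rewrite big_cons pi.
split; last first.
  have -> : EFin \o (fun o => F i o + \sum_(j <- r | p j) F j o) =
      (EFin \o F i) \+ (EFin \o (fun o => \sum_(j <- r | p j) F j o)) by [].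
  by apply: integrableD => //; exact: iF.
rewrite -ih1 /Exp expectation.unlock -fineD.
- by rewrite -integralD//; exact: iF.
- by apply: integrable_fin_num => //; exact: iF.
- exact: integrable_fin_num.
Qed.

Lemma Exp_Nround t : (1 <= t <= T)%N ->
  Exp M (Nround M t) = \sum_theta Exp M (Nreal M t theta) /\
  (Pr M).-integrable setT (EFin \o Nround M t).
Proof. by move=> tT; apply: Exp_sum => theta _; exact: arrival_integrable. Qed.

Lemma Exp_Nbetween t t' : (1 <= t)%N -> (t' <= T)%N ->
  Exp M (Nbetween M t t') = \sum_(t <= s < t'.+1) Exp M (Nround M s).
Proof.
move=> t1 t'T; pose p s := (t <= s < t'.+1)%N && true.
have iF s : p s -> (Pr M).-integrable setT (EFin \o Nround M s).
  rewrite /p andbT ltnS => /andP[ts st']; apply: (Exp_Nround _).2.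
  by rewrite (leq_trans t1) ?(leq_trans st').
rewrite big_nat_cond -(Exp_sum (index_iota t t'.+1) iF).1.
by congr Exp; apply/funext => o; rewrite /Nbetween big_nat_cond.
Qed.

Lemma Exp_ge0 (Y : Omega M -> R) : (forall o, 0 <= Y o) -> 0 <= Exp M Y.
Proof. by move=> Y0; rewrite fine_ge0// expectation_ge0. Qed.

Lemma Nround_ge0 t o : 0 <= Nround M t o.
Proof. by apply: sumr_ge0 => theta _; rewrite ler0n. Qed.

Lemma Nbetween_ge0 t t' o : 0 <= Nbetween M t t' o.
Proof. by apply: sumr_ge0 => s _; exact: Nround_ge0. Qed.

Lemma Exp_Nround_le t : (1 <= t <= T)%N -> Exp M (Nround M t) <= mu_max M.
Proof.
move=> tT; apply: (@le_bigmax_seq _ _ _ _ 0 t xpredT (fun t => Exp M (Nround M t))) => //.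
by rewrite mem_index_iota ltnS.
Qed.

Lemma ConfN_ge0 delta s t : 0 <= ConfN M delta s t.
Proof. exact: sqrtr_ge0. Qed.

Lemma ConfNtt delta t : ConfN M delta t t = 0.
Proof. by rewrite /ConfN subnn mulr0 !mul0r sqrtr0. Qed.

End expectation_of_arrivals.

(** The event measured by [perish_prob] at [Xlow]: the expected number of late units for which it
    holds is [eta]. *)
Definition perishes_early (R : realType) (T : nat) (M : model R T) (delta : R)
    (t : nat) (b : Unit M) (o : Omega M) : bool :=
  (t <= perish M b o)%N && ((perish M b o)%:R%:E <
    Order.min (T%:R : R)%:E (tau M delta b t (Xlow M delta)))%E.

(** The first clause holds almost surely; the second and the third will each fail with probability
    at most delta. All windows of rounds are controlled, since [tau] forecasts windows that start
    and end anywhere. *)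
Definition good_event (R : realType) (T : nat) (M : model R T) (delta : R)
    (o : Omega M) : Prop :=
  [/\ forall t theta, (1 <= t <= T)%N -> (1 <= arrival M t theta o)%N /\
        `|Nreal M t theta o - Exp M (Nreal M t theta)| <= rho_max M,
      forall s t, (s < t <= T)%N ->
        `|Nbetween M s.+1 t o - Exp M (Nbetween M s.+1 t)| <= ConfN M delta s t &
      forall t, (1 <= t <= T)%N ->
        \sum_(b | late_unit M delta t b) (perishes_early delta t b o)%:R <=
        eta M delta t + @ConfP R T delta t (eta M delta t)].

(** * The algorithm on the good event *)

Lemma sum_indicator_le1 (R : realType) (k m n : nat) :
  \sum_(m <= t < n) (k == t)%:R <= 1 :> R.
Proof.
rewrite -natr_sum lern1.
under eq_bigr do rewrite eq_sym.
rewrite -big_mkcond/= sum1_count count_uniq_mem ?leq_b1//.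
exact: iota_uniq.
Qed.

Section guardrail_run.
Context (R : realType) (T : nat) (M : model R T) (delta L : R) (o : Omega M).
Hypothesis L_gt0 : 0 < L.
Hypothesis delta01 : 0 < delta < 1.
Hypothesis lnT_ge1 : 1 <= ln (T%:R : R).
Hypothesis attained : Xlow_attained M delta.
Hypothesis ExpN_gt0 : 0 < Exp M (Ntotal M).
Hypothesis good : good_event delta o.
Implicit Types (b : Unit M) (t s u : nat).

Local Notation X := (Xlow M delta).
Local Notation Balg t := (Balg M delta L t o).
Local Notation amount := (alg_amount delta L o).
Local Notation demand := (round_demand delta L o).
Local Notation demand_upto := (total_demand delta L o).
Local Notation spoiled := (perished_amount delta L o).
Local Notation N t t' := (Nbetween M t t' o).
Local Notation P t := (Pupper M delta t).

Lemma T_gt1 : (1 < T)%N.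
Proof.
case: T lnT_ge1 => [|[|//]]; first by rewrite ln0// leNgt ltr01.
by rewrite ln1 leNgt ltr01.
Qed.

Lemma Xlow_ge0 : 0 <= X.
Proof. by have [] := attained. Qed.

Lemma Nupper_ge : Exp M (Ntotal M) <= Nupper M delta.
Proof. by rewrite lerDl ConfN_ge0. Qed.

Lemma Nupper_gt0 : 0 < Nupper M delta.
Proof. exact: lt_le_trans Nupper_ge. Qed.

Lemma ConfP_log_ge0 t : (0 < t)%N -> 0 <= ln (3 * t%:R * ln T%:R / delta).
Proof.
move=> t0; have /andP[d0 d1] := delta01.
rewrite ln_ge0// ler_pdivlMr// mul1r (le_trans (ltW d1))//.
have t1 : 1 <= t%:R :> R by rewrite ler1n.
have := ler_pM ler01 ler01 t1 lnT_ge1; rewrite -mulrA mulr1; lra.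
Qed.

Lemma eta_ge0 t : 0 <= eta M delta t.
Proof. by apply: sumr_ge0 => b _; rewrite fine_ge0. Qed.

Lemma ConfP_ge0 t x : (0 < t)%N -> 0 <= x -> 0 <= @ConfP R T delta t x.
Proof.
by move=> t0 x0; rewrite divr_ge0// addr_ge0 ?sqrtr_ge0// ConfP_log_ge0.
Qed.

Lemma Pupper_geP s (Y : R) : Y <= B M ->
  (forall s', (1 <= s' <= s)%N ->
    Y <= eta M delta s' + @ConfP R T delta s' (eta M delta s')) -> Y <= P s.
Proof.
move=> YB; elim: s => [|s ih] //= Ys; rewrite le_min Ys ?leqnn// andbT.
by apply: ih => s' /andP[s1 s's]; rewrite Ys// s1 leqW.
Qed.

Lemma Pupper_ge0 s : 0 <= P s.
Proof.
apply: Pupper_geP => [|s' /andP[s1 _]]; first exact: ler0n.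
by rewrite addr_ge0 ?eta_ge0// ConfP_ge0// eta_ge0.
Qed.

Lemma Pupper_le1 s : (0 < s)%N -> P s <= P 1.
Proof. by elim: s => // -[//|s] ih _; rewrite [leLHS]/= ge_min ih. Qed.

Lemma Nlower_before1 : Nlower_before M delta 1 = 0.
Proof.
rewrite /Nlower_before /Nlower ConfNtt subr0 Exp_Nbetween//.
by rewrite big_geq.
Qed.

(** In round 1 the rank threshold is 0, so every unit is late and [eta] is [mu]. This ties the
    reserve of the algorithm to the feasibility of [Xlow]. *)
Lemma Pupper1 : P 1 = Delta_upper M delta X.
Proof.
rewrite /= /Delta_upper (_ : eta M delta 1 = mu M delta X)//.
by apply: eq_bigl => b; rewrite /late_unit Nlower_before1 mul0r ceil0.
Qed.

(** Feasibility of [Xlow], read as: the initial budget covers a reserve of the kind that the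
    threshold leaves after a round served at [Xhigh]. It starts the induction on rounds. *)
Lemma B_ge : X * Nupper M delta + P 1 <= B M.
Proof.
have [_] := attained; rewrite -/(Xlow M delta) ler_pdivlMr ?Nupper_gt0//.
by rewrite Pupper1; lra.
Qed.

Lemma Nbetween_cat s t u : (s <= t.+1)%N -> (t <= u)%N ->
  N s u = N s t + N t.+1 u.
Proof. by move=> st tu; rewrite /Nbetween (big_cat_nat st). Qed.

Lemma Nlower_le s t : (1 <= s <= t.+1)%N -> (t <= T)%N ->
  Nlower M delta s t <= N s t.
Proof.
move=> /andP[s1 st] tT; move: st; rewrite leq_eqVlt => /predU1P[->|st].
  by rewrite /Nlower ConfNtt subr0 Exp_Nbetween// /Nbetween !big_geq.
case: s s1 st => // s _ st; have [_ /(_ s t) + _] := good.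
rewrite -ltnS st tT /= => /(_ isT); rewrite ler_norml => /andP[+ _].
by rewrite /Nlower/=; lra.
Qed.

Lemma Nupper_after_bounds t : (t <= T)%N ->
  N t.+1 T <= Nupper_after M delta t <= N t.+1 T + 2 * ConfN M delta t T.
Proof.
rewrite leq_eqVlt => /predU1P[->|tT].
  rewrite /Nupper_after ConfNtt Exp_Nbetween// /Nbetween !big_geq//.
  by rewrite mulr0 addr0 lexx.
have [_ /(_ t T) + _] := good.
rewrite tT leqnn /= => /(_ isT); rewrite ler_norml => /andP[h1 h2].
by rewrite /Nupper_after; apply/andP; split; lra.
Qed.

Lemma Nupper_after_ge0 t : (t <= T)%N -> 0 <= Nupper_after M delta t.
Proof.
by move=> /Nupper_after_bounds/andP[+ _]; apply: le_trans; exact: Nbetween_ge0.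
Qed.

Lemma Theta_gt0 : (0 < #|Theta M|)%N.
Proof.
rewrite lt0n; apply/negP => /eqP/card0_eq Th0; move: ExpN_gt0.
rewrite (_ : Ntotal M = cst 0); first by rewrite /Exp expectation_cst ltxx.
apply/funext => o'; rewrite /Ntotal /Nbetween big1// => t _.
by rewrite /Nround big_pred0// => theta; have := Th0 theta; rewrite inE.
Qed.

Lemma Nround_ge1 t : (1 <= t <= T)%N -> 1 <= Nround M t o.
Proof.
move=> tT; have /card_gt0P[theta _] := Theta_gt0.
rewrite /Nround (bigD1 theta)//= ler_wpDr//.
  by apply: sumr_ge0 => ? _; rewrite ler0n.
by have [/(_ t theta tT)[+ _] _ _] := good; rewrite ler1n.
Qed.

Lemma Nbetween_ge s t : (1 <= s)%N -> (t <= T)%N -> (t.+1 - s)%:R <= N s t.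
Proof.
move=> s1 tT.
have -> : (t.+1 - s)%:R = \sum_(s <= u < t.+1) (1 : R) by rewrite sumr_const_nat.
rewrite /Nbetween !big_nat; apply: ler_sum => u /andP[su ut].
by rewrite Nround_ge1// (leq_trans s1 su)/= (leq_trans _ tT).
Qed.

(** Round t is affordable and follows [rule] as if the shortage branch were absent. *)
Definition guarded t := Nround M t o * amount t <= Balg t /\
  if X * Nupper_after M delta t + P t <= Balg t - Nround M t o * (X + L)
  then amount t = X + L else amount t = X.

Definition guarded_upto t := forall s, (1 <= s <= t)%N -> guarded s.

Lemma guarded_uptoW t t' : (t <= t')%N -> guarded_upto t' -> guarded_upto t.
Proof.
by move=> tt' h s /andP[s1 st]; apply: h; rewrite s1 (leq_trans st).
Qed.

Lemma guarded_of_budget t : (1 <= t <= T)%N -> Nround M t o * X <= Balg t ->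
  guarded t.
Proof.
move=> tT Nt; rewrite /guarded /alg_amount /rule ltNge Nt/= /Xhigh.
case: ifP => // h; split=> //; rewrite -subr_ge0 (le_trans _ h)// addr_ge0//.
  by rewrite mulr_ge0 ?Xlow_ge0// Nupper_after_ge0//; case/andP: tT.
exact: Pupper_ge0.
Qed.

Lemma guarded_amount t : guarded t -> X <= amount t <= X + L.
Proof. by case=> _; case: ifP => _ ->; rewrite ?lexx lerDl (ltW L_gt0). Qed.

Lemma guarded_affordable t : guarded_upto t -> affordable delta L o t.
Proof.
move=> h s st; have g := h _ st; have [-> _] := g; rewrite andbT mulr_ge0//.
  exact: Nround_ge0.
by rewrite (le_trans Xlow_ge0)//; have /andP[] := guarded_amount g.
Qed.

Lemma demand_upto_ge t : guarded_upto t -> X * N 1 t <= demand_upto t.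
Proof.
move=> h; rewrite mulr_sumr /total_demand big_nat [leRHS]big_nat.
apply: ler_sum => s st; rewrite mulrC ler_wpM2l ?Nround_ge0//.
by have /andP[] := guarded_amount (h s st).
Qed.

Lemma demand_upto_le t t' : (t <= t')%N -> guarded_upto t' ->
  demand_upto t <= demand_upto t'.
Proof.
move=> tt' h; rewrite /total_demand [leRHS](@big_cat_nat _ _ _ t.+1)//=.
rewrite lerDl big_nat; apply: sumr_ge0 => s /andP[ts st'].
have s1 : (1 <= s <= t')%N by rewrite (leq_trans _ ts).
by have /andP[] := guarded_affordable h s1.
Qed.

(* A unit spoiling in round [u] outlived the demand up to [u], which dominates the one
   forecast by [tau] and [late_unit]. *)
Lemma spoiled_early s u b : (1 <= s <= u)%N -> (u < T)%N -> guarded_upto u ->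
  perish M b o = u -> demand_upto u < (rank M b)%:R ->
  late_unit M delta s b && perishes_early delta s b o.
Proof.
move=> /andP[s1 su] uT h bu ub.
have NX t : (t <= u)%N -> X * N 1 t < (rank M b)%:R.
  move=> tu; apply: le_lt_trans ub; apply: (le_trans (demand_upto_ge _)).
    exact: guarded_uptoW h.
  exact: demand_upto_le.
have NB t : (s.-1 <= t <= u)%N -> Nlower_before M delta s * X <= X * N 1 s.-1.
  by move=> _; rewrite mulrC ler_wpM2l ?Xlow_ge0// Nlower_le//
     (leq_trans (leq_pred s))// (leq_trans su)// ltnW.
apply/andP; split.
  rewrite /late_unit ceil_le_int (le_trans (NB s.-1 _))//.
    by rewrite leqnn (leq_trans (leq_pred s)).
  by apply/ltW/NX; rewrite (leq_trans (leq_pred s)).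
rewrite /perishes_early bu su/= lt_min lte_fin ltr_nat uT/=.
(* It suffices that no round t <= u enters the infimum defining [tau]: such a t would give rank b <=
   X * N 1 t, against [NX]. An empty infimum is covered as well. *)
apply: (@lt_le_trans _ _ (u.+1%:R)%:E); first by rewrite lte_fin ltr_nat.
apply: le_ereal_inf_tmp => _ [t [/andP[st tT] rt] <-].
rewrite lee_fin ler_nat ltnNge; apply/negP => tu.
have := NX _ tu; rewrite ltNge => /negP; apply; apply: (le_trans rt).
rewrite (@Nbetween_cat 1 s.-1)//; last by rewrite (leq_trans (leq_pred s)).
rewrite prednK// mulrDr lerD ?(NB t)//; first by rewrite (leq_trans (leq_pred s)).
by rewrite mulrC ler_wpM2l ?Xlow_ge0// Nlower_le ?s1 ?leqW.
Qed.

(** After exchanging the sums over rounds and units, each unit counts at most once, as it perishes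
    in a single round. The bound u < T matches [perish_prob], which leaves out round T. *)
Lemma sum_spoiled_le_early s u : (1 <= s)%N -> (u < T)%N -> guarded_upto u ->
  \sum_(s <= t < u.+1) spoiled t <=
  \sum_(b | late_unit M delta s b) (perishes_early delta s b o)%:R.
Proof.
move=> s1 uT h.
apply: (@le_trans _ _ (\sum_(s <= t < u.+1) \sum_b
    ((perish M b o == t) && (late_unit M delta s b && perishes_early delta s b o))%:R)).
  rewrite !big_nat; apply: ler_sum => t /andP[st]; rewrite ltnS => tu.
  have t1 : (1 <= t)%N := leq_trans s1 st.
  have h' := guarded_uptoW tu h.
  have := guarded_affordable h'; rewrite -(prednK t1) => /spoiled_le/le_trans; apply.
  rewrite (prednK t1); apply: ler_sum => b _; rewrite ler_nat.
  case: eqP => //= bt; case: ltP => //= bd.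
  by rewrite (@spoiled_early s t)// ?s1 ?st// (leq_ltn_trans tu).
rewrite exchange_big/= [leRHS]big_mkcond/=; apply: ler_sum => b _.
case: (late_unit _ _ _ _) => /=; last by rewrite big1// => t _; rewrite andbF.
under eq_bigr do rewrite -mulnb natrM.
rewrite -mulr_suml ler_piMl ?ler0n//.
exact: sum_indicator_le1.
Qed.

(** [Pupper] is a minimum over the forecasts of all rounds s' up to s. Spoilage from s on is at most
    spoilage from s' on, which the forecast of round s' covers. The maximum with 1 lets s = 0 stand
    for the start of the run. *)
Lemma sum_spoiled_le_Pupper s u : (u < T)%N -> guarded_upto u ->
  \sum_(maxn 1 s <= t < u.+1) spoiled t <= P (maxn 1 s).
Proof.
move=> uT h.
have mon s' s'' : (1 <= s' <= s'')%N ->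
    \sum_(s'' <= t < u.+1) spoiled t <= \sum_(s' <= t < u.+1) spoiled t.
  move=> /andP[s1 s's]; have [us|su] := leqP s'' u.+1; last first.
    rewrite big_geq ?(ltnW su)//; rewrite big_nat; apply: sumr_ge0 => t /andP[s't tu].
    have t1 := leq_trans s1 s't; rewrite -(prednK t1) spoiled_ge0// prednK//.
    by apply: guarded_affordable; exact: guarded_uptoW h.
  rewrite [leRHS](@big_cat_nat _ _ _ s'')//= lerDr big_nat; apply: sumr_ge0 => t.
  move=> /andP[s't ts]; have t1 := leq_trans s1 s't.
  rewrite -(prednK t1) spoiled_ge0// prednK//.
  by apply: guarded_affordable; apply: guarded_uptoW h; rewrite -ltnS (leq_trans ts).
have w s' : (1 <= s' <= maxn 1 s)%N -> (s' <= T)%N ->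
  \sum_(maxn 1 s <= t < u.+1) spoiled t <=
  eta M delta s' + @ConfP R T delta s' (eta M delta s').
  move=> s's s'T; apply: (le_trans (mon _ _ s's)); have /andP[s1 _] := s's.
  apply: (le_trans (sum_spoiled_le_early s1 uT h)).
  by have [_ _ ->] := good; rewrite ?s1.
apply: Pupper_geP.
  apply: (le_trans (sum_spoiled_le_early (leq_maxl 1 s) uT h)).
  apply: (@le_trans _ _ (\sum_b (1 : R))); last first.
    by rewrite sumr_const; exact: lexx.
  by rewrite big_mkcond; apply: ler_sum => b _; case: ifP => // _; rewrite lern1 leq_b1.
move=> s' s's; have [s'T|Ts'] := leqP s' T; first exact: w.
(* A round s' beyond T forces s > u, so nothing is summed. *)
rewrite big_geq.
  by rewrite addr_ge0 ?eta_ge0// ConfP_ge0 ?eta_ge0//; case/andP: s's.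
by case/andP: s's => _ /(leq_trans (ltnW Ts')); exact: leq_trans uT.
Qed.

(* [s] is the last round in which [X + L] was handed out, or 0 if there is none. *)
Lemma guarded_run t : (t <= T)%N -> guarded_upto t /\
  exists s, (s <= t)%N /\
    X * (Nupper_after M delta s - N s.+1 t) + P (maxn 1 s) <=
    Balg t.+1 + \sum_(maxn 1 s <= u < t.+1) spoiled u.
Proof.
elim: t => [_|t ih tT].
  split; first by move=> s; rewrite leqn0 => /andP[/[swap]/eqP->].
  exists 0%N; split => //; rewrite maxn0 big_geq// addr0 /Nbetween big_geq// subr0.
  exact: B_ge.
have [h [s [st Bt]]] := ih (ltnW tT).
(* The spoilage since round s is at most P (maxn 1 s), so the budget still contains X times all
   remaining arrivals, in particular those of the current round. *)
have g : guarded t.+1.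
  apply: guarded_of_budget => //.
  have Ps := sum_spoiled_le_Pupper s tT h.
  have : X * N t.+1 T <= X * (Nupper_after M delta s - N s.+1 t).
    rewrite ler_wpM2l ?Xlow_ge0// lerBrDl -Nbetween_cat//; last exact: ltnW.
    by have /andP[] := Nupper_after_bounds (leq_trans st (ltnW tT)).
  rewrite (@Nbetween_cat _ t.+1)// {1}/Nbetween big_nat1.
  have := mulr_ge0 Xlow_ge0 (Nbetween_ge0 t.+2 T o); rewrite mulrDr; lra.
have h' : guarded_upto t.+1.
  move=> s' /andP[s1]; rewrite leq_eqVlt => /predU1P[-> //|s't].
  by apply: h; rewrite s1.
split => //.
(* After a round at X + L the reserve is read off the threshold, and the sum consists of the
   spoilage of this very round, which cancels the loss in the budget. After a round at X the old s
   is kept: the reserve and the budget both lose X per arrival. *)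
have [_] := g; case: ifPn => [Q xE|_ xE].
  exists t.+1; split => //; rewrite (maxn_idPr _)// big_nat1.
  rewrite /Nbetween big_geq// subr0.
  by rewrite BalgS// -/(spoiled _) subrK /round_demand xE.
exists s; split; first exact: leqW.
have ms : (maxn 1 s <= t.+1)%N by rewrite geq_max (leqW st).
rewrite BalgS// -/(spoiled _) (big_nat_recr _ _ _ ms)/=.
rewrite (@Nbetween_cat s.+1 t)// {2}/Nbetween big_nat1 /round_demand xE.
by move: Bt; lra.
Qed.

Lemma guarded_all : guarded_upto T.
Proof. exact: (guarded_run (leqnn T)).1. Qed.

(** The first case is that of no round at X so far; in the second, s is the last such round. Of the
    two terms P 1, one bounds the reserve in the threshold that failed at s, the other what has
    spoiled before s. Every later round takes X + L per arrival from the bound. *)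
Lemma efficiency_run t : (t <= T)%N ->
  (B M - demand_upto t <= B M - (X + L) * N 1 t) \/
  exists s, (1 <= s <= t)%N /\
    B M - demand_upto t <= Nround M s o * L + X * Nupper_after M delta s + 2 * P 1
      - (X + L) * N s.+1 t.
Proof.
elim: t => [_|t ih tT].
  by left; rewrite /total_demand /Nbetween !big_geq// mulr0.
have g : guarded t.+1 by apply: guarded_all.
have [_] := g; case: ifPn => [_ xE|Q xE].
  case: (ih (ltnW tT)) => [le|[s [/andP[s1 st] le]]];
    [left|right; exists s; rewrite s1 leqW//; split => //];
    rewrite demand_uptoS (@Nbetween_cat _ t)// {2}/Nbetween big_nat1 /round_demand xE;
    move: le; lra.
right; exists t.+1; split; first by rewrite leqnn.
rewrite {1}/Nbetween big_geq// mulr0 subr0.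
rewrite demand_uptoS /round_demand xE.
have := @budget_conservation _ _ M delta L o t.
have := @sum_spoiled_le_Pupper 1 t tT (guarded_uptoW (ltnW tT) guarded_all).
have := @Pupper_le1 t.+1 isT.
move: Q; rewrite -ltNge maxnn; lra.
Qed.

(** * Bounds on the metrics in terms of the parameters *)

Hypothesis L_le1 : L <= 1.

Local Notation S := (slack M delta 1).

Lemma slackX k : slack M delta k = S ^+ k.
Proof. by rewrite /slack expr1. Qed.

Lemma slack_ge : [/\ 1 <= S, beta_avg M <= S, #|Theta M|%:R <= S, w_max M <= S &
  [/\ mu_max M <= S, rho_max M <= S & 1 + ln T%:R + ln (1 / delta) <= S]].
Proof.
have /andP[d0 d1] := delta01.
have beta0 : 0 <= beta_avg M by rewrite divr_ge0 ?ler0n// ltW.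
have n0 : 0 <= #|Theta M|%:R :> R by rewrite ler0n.
have w0 : 0 <= w_max M by exact: bigmax_ge_id.
have mu0 : 0 <= mu_max M by exact: bigmax_ge_id.
have rho0 : 0 <= rho_max M by exact: bigmax_ge_id.
have s0 : 0 <= sigma2_max M by exact: bigmax_ge_id.
have s1 : 0 <= sigma2_min M.
  apply: le_bigmin => // t _; apply: le_bigmin => // theta _.
  by rewrite fine_ge0// variance_ge0.
have l0 : 0 <= ln (1 / delta) :> R by rewrite ln_ge0// ler_pdivlMr// mul1r ltW.
have := lnT_ge1; rewrite /slack expr1 => l1.
by split; [..|split]; lra.
Qed.

Lemma S_ge1 : 1 <= S. Proof. by have [] := slack_ge. Qed.

Lemma S_ge0 : 0 <= S. Proof. exact: le_trans S_ge1. Qed.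

Lemma ler_SX m n : (m <= n)%N -> S ^+ m <= S ^+ n.
Proof. exact: ler_weXn2l S_ge1 _ _. Qed.

Lemma ln_conf_le : 0 <= ln (2 * T%:R ^+ 2 / delta) <= 2 * S.
Proof.
have /andP[d0 d1] := delta01; have T0 : 0 < T%:R :> R by rewrite ltr0n ltnW ?T_gt1.
have T1 : 1 <= T%:R :> R by rewrite ler1n ltnW ?T_gt1.
apply/andP; split.
  rewrite ln_ge0// ler_pdivlMr// mul1r (le_trans (ltW d1))//.
  by have := ler_pM ler01 ler01 T1 T1; rewrite -expr2; lra.
have -> : 2 * T%:R ^+ 2 / delta = 2 * T%:R ^+ 2 * (1 / delta) :> R by rewrite mul1r.
have T2 : 0 < T%:R ^+ 2 :> R by rewrite exprn_gt0.
rewrite (lnM (x := 2 * T%:R ^+ 2)) ?posrE ?mulr_gt0 ?invr_gt0//.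
rewrite (lnM (x := 2)) ?posrE// lnXn// mulr2n.
have ln2 : ln 2 <= 1 :> R by have := @le_ln1Dx R 1; apply; lra.
have [_ _ _ _ [_ _]] := slack_ge.
have l0 : 0 <= ln (1 / delta) :> R by rewrite ln_ge0// ler_pdivlMr// mul1r ltW.
have := S_ge1; lra.
Qed.

(** Under the root, #|Theta|, rho_max^2 and the logarithm cost S, S^2 and 2 S; with the leading 2
    this is (2 S^2)^2. *)
Lemma ConfN_le s t : ConfN M delta s t <= 2 * S ^+ 2 * Num.sqrt (t - s)%:R.
Proof.
have S20 : 0 <= 2 * S ^+ 2 by rewrite mulr_ge0// exprn_ge0// S_ge0.
rewrite -[X in X * Num.sqrt _]ger0_norm// -sqrtr_sqr -sqrtrM ?sqr_ge0// ler_wsqrtr//.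
have /andP[l0 l1] := ln_conf_le; have [_ _ nS _ [_ rS _]] := slack_ge.
have n0 : 0 <= #|Theta M|%:R :> R by rewrite ler0n.
have r0 : 0 <= rho_max M by exact: bigmax_ge_id.
have r2 : rho_max M ^+ 2 <= S ^+ 2 by rewrite lerXn2r ?nnegrE ?S_ge0.
rewrite [leRHS]mulrC.
have -> : 2 * (t - s)%:R * #|Theta M|%:R * rho_max M ^+ 2 * ln (2 * T%:R ^+ 2 / delta) =
  (t - s)%:R * (2 * (#|Theta M|%:R * rho_max M ^+ 2 * ln (2 * T%:R ^+ 2 / delta))) by ring.
rewrite ler_wpM2l ?ler0n//.
have -> : (2 * S ^+ 2) ^+ 2 = 2 * (S * S ^+ 2 * (2 * S)) by ring.
by rewrite ler_wpM2l// ler_pM// ?mulr_ge0 ?sqr_ge0// ler_pM ?sqr_ge0.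
Qed.

Lemma sqrtT_le : Num.sqrt T%:R <= T%:R :> R.
Proof.
have T1 : 1 <= T%:R :> R by rewrite ler1n ltnW ?T_gt1.
by rewrite -[leRHS]ger0_norm ?ler0n// -sqrtr_sqr ler_wsqrtr// expr2 ler_peMl.
Qed.

Lemma Nupper_le : Nupper M delta <= 3 * S ^+ 2 * T%:R.
Proof.
have [S1 _ _ _ [mS _ _]] := slack_ge.
apply: (@le_trans _ _ (T%:R * S + 2 * S ^+ 2 * T%:R)).
  apply: lerD.
    rewrite /Ntotal Exp_Nbetween//.
    apply: (@le_trans _ _ (\sum_(1 <= s < T.+1) S)); last first.
      by rewrite sumr_const_nat subn1/= mulr_natl.
    rewrite !big_nat; apply: ler_sum => s sT; apply: le_trans mS.
    exact: Exp_Nround_le.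
  apply: le_trans (ConfN_le 0 T) _; rewrite subn0 ler_wpM2l ?sqrtT_le//.
  by rewrite mulr_ge0// exprn_ge0// S_ge0.
have := ler_SX (isT : 1 <= 2)%N; rewrite expr1 => h.
have := ler_wpM2l (ler0n R T) h; lra.
Qed.

Lemma Lperish_ge : P 1 <= Nupper M delta * Lperish M delta.
Proof.
rewrite /Lperish mulrBr mulrCA divff ?gt_eqF ?Nupper_gt0// mulr1.
have := B_ge; lra.
Qed.

Lemma Lperish_ge0 : 0 <= Lperish M delta.
Proof.
rewrite -(pmulr_rge0 _ Nupper_gt0).
exact: le_trans (Pupper_ge0 1) Lperish_ge.
Qed.

Lemma BE : B M = Nupper M delta * (Lperish M delta + X).
Proof. by rewrite /Lperish subrK mulrCA divff ?mulr1// gt_eqF ?Nupper_gt0. Qed.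

Lemma Xlow_le : X <= S.
Proof.
have [_ bS _ _ _] := slack_ge; apply: le_trans bS.
apply: (@le_trans _ _ (B M / Nupper M delta)).
  by rewrite -subr_ge0 -/(Lperish M delta) Lperish_ge0.
by rewrite ler_wpM2l ?ler0n// lef_pV2 ?posrE ?Nupper_gt0// Nupper_ge.
Qed.

Lemma Ntotal_bounds : T%:R <= N 1 T /\
  N 1 T <= Nupper M delta <= N 1 T + 4 * S ^+ 2 * Num.sqrt T%:R.
Proof.
split; first by have := Nbetween_ge (leqnn 1) (leqnn T); rewrite subn1.
have /andP[-> h] := Nupper_after_bounds (leq0n T).
apply: le_trans h _; rewrite lerD2l.
have := ConfN_le 0 T; rewrite subn0; lra.
Qed.

(** The excess over Lperish is (B / Nupper) * (Nupper - N) / N. Its first factor is at most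
    beta_avg, the numerator is of order sqrt T by concentration, and N >= T because each round has
    an arrival. *)
Lemma share_bounds : 0 <= B M / N 1 T - X <= Lperish M delta + 4 * S ^+ 3 / Num.sqrt T%:R.
Proof.
have [TN /andP[NU UN]] := Ntotal_bounds.
have T0 : 0 < T%:R :> R by rewrite ltr0n ltnW ?T_gt1.
have N0 : 0 < N 1 T by exact: lt_le_trans TN.
have U0 := Nupper_gt0.
have s0 : 0 < Num.sqrt T%:R :> R by rewrite sqrtr_gt0.
have -> : B M / N 1 T - X = Lperish M delta
    + B M / Nupper M delta * ((Nupper M delta - N 1 T) / N 1 T).
  by rewrite /Lperish; field; rewrite !gt_eqF.
have bS : B M / Nupper M delta <= S.
  have [_ bS _ _ _] := slack_ge; apply: le_trans bS.
  by rewrite ler_wpM2l ?ler0n// lef_pV2 ?posrE// Nupper_ge.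
have b0 : 0 <= B M / Nupper M delta by rewrite divr_ge0 ?ler0n// ltW.
have d0 : 0 <= (Nupper M delta - N 1 T) / N 1 T by rewrite divr_ge0 ?subr_ge0// ltW.
apply/andP; split.
  exact: addr_ge0 Lperish_ge0 (mulr_ge0 b0 d0).
rewrite lerD2l.
have -> : 4 * S ^+ 3 / Num.sqrt T%:R = S * (4 * S ^+ 2 * Num.sqrt T%:R / T%:R).
  have TE : T%:R = Num.sqrt T%:R ^+ 2 :> R by rewrite sqr_sqrtr ?ler0n.
  by rewrite [in X in _ = _ * (_ / X)]TE; field; rewrite gt_eqF.
apply: ler_pM => //; rewrite ler_pdivrMr//.
apply: (@le_trans _ _ (4 * S ^+ 2 * Num.sqrt T%:R)); first by rewrite lerBlDl.
have a0 : 0 <= 4 * S ^+ 2 * Num.sqrt T%:R.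
  exact: mulr_ge0 (mulr_ge0 (ler0n _ 4) (sqr_ge0 _)) (ltW s0).
rewrite -[leRHS]mulrA ler_peMr//.
by rewrite mulrC ler_pdivlMr// mul1r.
Qed.

Lemma Xalg_bounds t theta : (1 <= t <= T)%N ->
  X <= Xalg M delta L t theta o <= X + L.
Proof. by move=> tT; apply: guarded_amount; exact: guarded_all. Qed.

Lemma w_bounds theta : 0 < w M theta <= S.
Proof.
have [_ _ _ wS _] := slack_ge; rewrite w_gt0 (le_trans _ wS)//.
exact: le_bigmax.
Qed.

Lemma Envy_le : Envy M delta L o <= S * L.
Proof.
have SL : 0 <= S * L by rewrite mulr_ge0 ?S_ge0// ltW.
rewrite /Envy big_nat_cond; apply: bigmax_le => // t; rewrite andbT ltnS => tT.
rewrite big_nat_cond; apply: bigmax_le => // t'; rewrite andbT ltnS => t'T.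
apply: bigmax_le => // theta _; apply: bigmax_le => // theta' _.
have /andP[x1 x2] := Xalg_bounds theta tT.
have /andP[y1 y2] := Xalg_bounds theta' t'T.
have /andP[w0 wS] := w_bounds theta.
apply: (@le_trans _ _ (w M theta * L)); last by rewrite ler_wpM2r// ltW.
by rewrite ler_wpM2l ?(ltW w0)//; lra.
Qed.

(** Allocation and fair share both lie above X, within L and within the bound of [share_bounds]
    respectively, so their distance is at most the larger of the two. *)
Lemma Delta_EF_le : Delta_EF M delta L o <=
  5 * S ^+ 4 * Num.max L (Lperish M delta + 1 / Num.sqrt T%:R).
Proof.
have Lp0 := Lperish_ge0.
have s0 : 0 <= (Num.sqrt T%:R)^-1 :> R by rewrite invr_ge0 sqrtr_ge0.
set m := Num.max _ _.
have mL : L <= m by rewrite le_max lexx.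
have ms : Lperish M delta + (Num.sqrt T%:R)^-1 <= m by rewrite le_max mul1r lexx orbT.
have m0 : 0 <= m by rewrite (le_trans _ mL)// ltW.
have S1 := S_ge1; have S13 := ler_SX (isT : 0 <= 3)%N; rewrite expr0 in S13.
have c0 : 0 <= 5 * S ^+ 4 * m by rewrite !mulr_ge0// S_ge0.
rewrite /Delta_EF big_nat_cond; apply: bigmax_le => // t; rewrite andbT ltnS => tT.
apply: bigmax_le => // theta _.
have /andP[x1 x2] := Xalg_bounds theta tT; have /andP[b1 b2] := share_bounds.
have /andP[w0 wS] := w_bounds theta.
rewrite normrM (gtr0_norm w0).
have -> : 5 * S ^+ 4 * m = S * (5 * S ^+ 3 * m) by ring.
apply: ler_pM => //; first exact: ltW.
apply: (@le_trans _ _ (m + 4 * S ^+ 3 * m)); last first.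
  have := ler_wpM2r m0 S13; lra.
have h : 4 * S ^+ 3 * (Lperish M delta + (Num.sqrt T%:R)^-1) <= 4 * S ^+ 3 * m.
  by rewrite ler_wpM2l//; lra.
have h' : Lperish M delta <= 4 * S ^+ 3 * Lperish M delta by rewrite ler_peMl//; lra.
move: x1 x2 b1 b2 h h'; rewrite /Ntotal; move: (Xalg _ _ _ _ _ _) (B M / _) => x y.
rewrite mulrDr; move: (4 * S ^+ 3 * _) (4 * S ^+ 3 * _) (4 * S ^+ 3 * _).
by move=> *; rewrite ler_norml; apply/andP; split; lra.
Qed.

Lemma Delta_efficiencyE : Delta_efficiency M delta L o = B M - demand_upto T.
Proof.
by rewrite /Delta_efficiency; congr (_ - _); apply: eq_bigr => t _; exact: demandE.
Qed.

(** Serving at least X per arrival already gives this: B - X * N = Nupper * Lperish + X * (Nupper -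
    N), and the last difference is of order sqrt T. *)
Lemma Delta_efficiency_le_sqrt : Delta_efficiency M delta L o <=
  4 * S ^+ 3 * (Num.sqrt T%:R + T%:R * Lperish M delta).
Proof.
rewrite Delta_efficiencyE; have Dge := demand_upto_ge guarded_all.
have [_ /andP[NU UN]] := Ntotal_bounds.
apply: (@le_trans _ _ (Nupper M delta * Lperish M delta + X * (Nupper M delta - N 1 T))).
  by rewrite {1}BE; lra.
rewrite addrC [leRHS]mulrDr; apply: lerD.
  have -> : 4 * S ^+ 3 * Num.sqrt T%:R = S * (4 * S ^+ 2 * Num.sqrt T%:R) by ring.
  by apply: ler_pM; rewrite ?Xlow_ge0 ?Xlow_le ?subr_ge0// lerBlDl.
rewrite mulrA ler_wpM2r ?Lperish_ge0//; apply: le_trans Nupper_le _.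
rewrite ler_wpM2r ?ler0n//; have := ler_SX (isT : 2 <= 3)%N.
have := exprn_ge0 2 S_ge0; lra.
Qed.

(** Applied with y = sqrt (T - t): the forecast error grows like y, whereas the extra L per arrival
    recovers at least L * y^2. *)
Lemma linear_sub_quadratic (y : R) : 4 * S ^+ 3 * y - L * y ^+ 2 <= 4 * S ^+ 6 / L.
Proof.
rewrite -subr_ge0 (_ : _ - _ = L * (y - 2 * S ^+ 3 / L) ^+ 2).
  by rewrite mulr_ge0 ?sqr_ge0// ltW.
by field; rewrite gt_eqF.
Qed.

(** The constant 6 arises twice: as 2 + 4 from the round s and the completed square, and as 2 * 3
    from two copies of P 1 with Nupper <= 3 S^2 T. *)
Lemma Delta_efficiency_le_inv : Delta_efficiency M delta L o <=
  6 * S ^+ 6 * (L^-1 + T%:R * Lperish M delta).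
Proof.
rewrite Delta_efficiencyE.
have S1 := S_ge1; have S0 := S_ge0; have X0 := Xlow_ge0; have XS := Xlow_le.
have TL0 : 0 <= T%:R * Lperish M delta by rewrite mulr_ge0 ?ler0n ?Lperish_ge0.
have NL : Nupper M delta * Lperish M delta <= 3 * S ^+ 6 * (T%:R * Lperish M delta).
  rewrite mulrA ler_wpM2r ?Lperish_ge0//; apply: le_trans Nupper_le _.
  by rewrite ler_wpM2r ?ler0n// ler_wpM2l// ler_SX.
have L10 : 0 < L^-1 by rewrite invr_gt0.
have S60 : 0 <= S ^+ 6 by rewrite exprn_ge0.
have S6L : 0 <= S ^+ 6 * L^-1 by rewrite mulr_ge0// ltW.
have S6T : 0 <= S ^+ 6 * (T%:R * Lperish M delta) by rewrite mulr_ge0.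
have gap t : (t <= T)%N ->
    X * (Nupper_after M delta t - N t.+1 T) - L * N t.+1 T <= 4 * S ^+ 6 / L.
  move=> tT; apply: le_trans (linear_sub_quadratic (Num.sqrt (T - t)%:R)).
  have /andP[U1 U2] := Nupper_after_bounds tT.
  rewrite sqr_sqrtr ?ler0n//; apply: lerB; last first.
    by rewrite ler_wpM2l ?(ltW L_gt0)//; have := @Nbetween_ge t.+1 T isT (leqnn T).
  have -> : 4 * S ^+ 3 * Num.sqrt (T - t)%:R =
    S * (2 * (2 * S ^+ 2 * Num.sqrt (T - t)%:R)) by ring.
  apply: ler_pM => //; first by rewrite subr_ge0.
  by rewrite lerBlDl; apply: le_trans U2 _; rewrite lerD2l ler_wpM2l// ConfN_le.
have [h|[s [/andP[s1 sT] h]]] := efficiency_run (leqnn T).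
  apply: le_trans h _; have := gap 0%N isT.
  change (Nupper_after M delta 0) with (Nupper M delta); rewrite BE; move: NL S6L S6T; lra.
apply: le_trans h _; have := gap s sT; have := Lperish_ge.
(* A single round has at most E N_s + #|Theta| * rho_max <= S + S^2 arrivals, and L <= 1 <= 1 /
   L. *)
have NsL : Nround M s o * L <= 2 * S ^+ 6 * L^-1.
  apply: ler_pM; [exact: Nround_ge0|exact: ltW| |]; last first.
    by rewrite (le_trans L_le1)// -[leLHS]invr1 lef_pV2 ?posrE.
  apply: (@le_trans _ _ (S + S * S)); last first.
    by have := ler_SX (isT : 1 <= 6)%N; have := ler_SX (isT : 2 <= 6)%N;
      rewrite expr1 expr2; lra.
  have sT' : (1 <= s <= T)%N by rewrite s1.
  have [_ _ nS _ [mS rS _]] := slack_ge.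
  apply: (@le_trans _ _ (Exp M (Nround M s) + #|Theta M|%:R * rho_max M)); last first.
    apply: lerD; first by apply: le_trans mS; exact: Exp_Nround_le.
    by apply: ler_pM => //; exact: bigmax_ge_id.
  rewrite (Exp_Nround M sT').1.
  have -> : #|Theta M|%:R * rho_max M = \sum_(theta : Theta M) rho_max M.
    by rewrite sumr_const mulr_natl.
  rewrite -big_split/=; apply: ler_sum => theta _.
  have [/(_ s theta sT')[_ +] _ _] := good.
  by rewrite ler_norml => /andP[_]; lra.
move: NL S6L S6T NsL; lra.
Qed.

Lemma guardrail_metrics :
  [/\ Delta_EF M delta L o <= 6 * slack M delta 6 *
        Num.max L (Lperish M delta + 1 / Num.sqrt T%:R),
      Delta_efficiency M delta L o <= 6 * slack M delta 6 *
        (Num.min (Num.sqrt T%:R) (L^-1 + Num.sqrt (T%:R * L^-1 * Lperish M delta))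
         + T%:R * Lperish M delta) &
      Envy M delta L o <= 6 * slack M delta 6 * L].
Proof.
have Lp0 := Lperish_ge0; have TL0 : 0 <= T%:R * Lperish M delta by rewrite mulr_ge0.
have s6 n : (n <= 6)%N -> forall c, 0 <= c <= 6 -> c * S ^+ n <= 6 * S ^+ 6.
  move=> n6 c /andP[c0 c6]; apply: ler_pM => //; [exact/exprn_ge0/S_ge0|exact: ler_SX].
rewrite slackX; split.
- apply: le_trans Delta_EF_le _; rewrite ler_wpM2r ?s6 ?le_max ?(ltW L_gt0)//.
  by apply/andP; split; lra.
- have [h|h] := leP (Num.sqrt T%:R) (L^-1 + Num.sqrt (T%:R * L^-1 * Lperish M delta)).
    apply: le_trans Delta_efficiency_le_sqrt _.
    rewrite ler_wpM2r ?addr_ge0 ?sqrtr_ge0 ?s6//.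
    by apply/andP; split; lra.
  apply: le_trans Delta_efficiency_le_inv _.
  rewrite ler_wpM2l ?mulr_ge0 ?exprn_ge0 ?S_ge0//.
  by rewrite lerD2r lerDl sqrtr_ge0.
- apply: le_trans Envy_le _; rewrite ler_wpM2r ?(ltW L_gt0)//.
  have := s6 1%N isT 1; rewrite mul1r expr1; apply; apply/andP; split; lra.
Qed.

End guardrail_run.

(** * Probability of the good event *)

Section model_data.
Context (R : realType) (T : nat) (M : model R T).
Implicit Types (t : nat) (delta L : R).

(** The finitely many natural-valued variables that a run reads. An event invariant under this
    relation is measurable, which spares an analysis of [state]. *)
Definition same_data (o o' : Omega M) : Prop :=
  (forall t theta, (1 <= t <= T)%N -> arrival M t theta o = arrival M t theta o')
  /\ (forall b, perish M b o = perish M b o').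

Lemma measurable_of_same_data (A : set (Omega M)) :
  (forall o o', same_data o o' -> A o -> A o') -> measurable A.
Proof.
move=> oA; apply: (@measurable_of_nat_family _ _ ('I_T * Theta M + Unit M)%type
  (fun i o => match i with
    | inl (s, theta) => arrival M s.+1 theta o | inr b => perish M b o end)).
  by case=> [[s theta]|b]; exact: measurable_funPT.
move=> o o' eqoo; apply: oA; split=> [t theta /andP[t1 tT]|b].
  have t1T : (t.-1 < T)%N by rewrite prednK.
  by have := eqoo (inl (Ordinal t1T, theta)); rewrite /= prednK.
exact: eqoo (inr b).
Qed.

Section same_data_eq.
Context (o o' : Omega M) (oo : same_data o o').

Lemma same_data_Nround t : (1 <= t <= T)%N -> Nround M t o = Nround M t o'.
Proof.
by move=> tT; apply: eq_bigr => theta _; rewrite /Nreal (oo.1 t theta tT).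
Qed.

Lemma same_data_Nbetween s t : (1 <= s)%N -> (t <= T)%N ->
  Nbetween M s t o = Nbetween M s t o'.
Proof.
move=> s1 tT; apply: eq_big_nat => u /andP[su ut].
by rewrite same_data_Nround// (leq_trans s1 su) (leq_trans _ tT).
Qed.

Lemma same_data_rule delta L t bud : (1 <= t <= T)%N ->
  rule M delta L t bud o = rule M delta L t bud o'.
Proof. by move=> tT; rewrite /rule same_data_Nround. Qed.

Lemma same_data_state delta L t : (t <= T)%N ->
  state M delta L t o = state M delta L t o'.
Proof.
elim: t => // t ih tT; rewrite /= ih ?(ltnW tT)//; case: (state _ _ _ _ _) => bud rest.
have -> : \sum_theta Nreal M t.+1 theta o * rule M delta L t.+1 bud o =
    \sum_theta Nreal M t.+1 theta o' * rule M delta L t.+1 bud o'.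
  apply: eq_bigr => theta _.
  by rewrite same_data_rule ?tT// /Nreal (oo.1 t.+1 theta tT).
under eq_bigl do rewrite oo.2.
by congr pair; apply/funext => b; rewrite oo.2.
Qed.

Lemma same_data_Xalg delta L t theta : (1 <= t <= T)%N ->
  Xalg M delta L t theta o = Xalg M delta L t theta o'.
Proof.
move=> tT; have /andP[_ tT'] := tT.
by rewrite /Xalg same_data_rule// /Balg same_data_state// (leq_trans (leq_pred t)).
Qed.

Lemma same_data_Delta_EF delta L :
  Delta_EF M delta L o = Delta_EF M delta L o'.
Proof.
apply: eq_big_nat => t; rewrite ltnS => tT; apply: eq_bigr => theta _.
by rewrite same_data_Xalg// /Ntotal same_data_Nbetween.
Qed.

Lemma same_data_Envy delta L : Envy M delta L o = Envy M delta L o'.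
Proof.
apply: eq_big_nat => t; rewrite ltnS => tT; apply: eq_big_nat => t'.
rewrite ltnS => t'T; apply: eq_bigr => theta _; apply: eq_bigr => theta' _.
by rewrite !same_data_Xalg.
Qed.

Lemma same_data_Delta_efficiency delta L :
  Delta_efficiency M delta L o = Delta_efficiency M delta L o'.
Proof.
congr (_ - _); apply: eq_big_nat => t; rewrite ltnS => tT; apply: eq_bigr => theta _.
by rewrite same_data_Xalg// /Nreal (oo.1 t theta tT).
Qed.

Lemma same_data_good delta : good_event delta o -> good_event delta o'.
Proof.
move=> [g1 g2 g3]; split.
- move=> t theta tT; have := g1 t theta tT.
  by rewrite /Nreal (oo.1 t theta tT).
- move=> s t st; rewrite -same_data_Nbetween//; first exact: g2.
  by case/andP: st.
- move=> t tT; apply: le_trans (g3 t tT); rewrite le_eqVlt; apply/orP; left.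
  by apply/eqP; apply: eq_bigr => b _; rewrite /perishes_early oo.2.
Qed.

End same_data_eq.

(** Arrivals and perishing times form one independent family; h selects a subfamily and f maps it
    into a finite type. The conclusion has the form in which the tail bounds assume independence. *)
Lemma independent_images (I F : finType) (h : I -> 'I_T * Theta M + Unit M)
    (f : I -> nat -> F) :
  injective h ->
  let Z i o := f i (match h i with
    | inl (s, theta) => arrival M s.+1 theta o | inr b => perish M b o end) in
  (forall i x, measurable (Z i @^-1` [set x])) /\
  forall x : I -> F, prob (Pr M) [set o | forall i, Z i o = x i] =
    \prod_i prob (Pr M) (Z i @^-1` [set x i]).
Proof.
move=> hI Z; have mZ i x : measurable (Z i @^-1` [set x]).
  apply: measurable_of_same_data => o o' [oa ob] /=; rewrite /Z.
  by case: (h i) => [[s theta]|b]; rewrite ?oa ?ob//= ltnS.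
split => // x.
(* Injectivity of h makes A (h i) the preimage of x i; off the image of h the condition is
   vacuous. *)
pose A j : set nat := [set n | forall i, h i = j -> f i n = x i].
have AE i : A (h i) = [set n | f i n = x i].
  apply/seteqP; split => n /=; first exact.
  by move=> fn i' /hI ->.
have := @independence _ _ M (h @: [set: I])%SET A (fun=> Logic.I).
rewrite big_imset/=; last by move=> i j _ _; exact: hI.
under eq_bigr => i _.
  rewrite AE (_ : _ @^-1` _ = Z i @^-1` [set x i])// probE//; over.
rewrite -(big_morph EFin EFinM erefl).
rewrite (_ : \bigcap_(_ in _) _ = [set o | forall i, Z i o = x i]).
  rewrite probE; last first.
    rewrite (_ : [set o | _] = \bigcap_(i in [set: I]) (Z i @^-1` [set x i])).
      by apply: fin_bigcap_measurable => //; exact: finite_finset.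
    by apply/seteqP; split => o Zo i //=; exact: Zo.
  by move=> [->]; apply: eq_bigl => i; rewrite inE.
apply/seteqP; split => o /= Ho.
  move=> i; have /(_ _)/[!AE] := Ho (h i); apply.
  by rewrite /= imset_f// inE.
by move=> j /imsetP[i _ ->]; rewrite AE; exact: Ho.
Qed.

End model_data.

(** * Concentration of arrivals and of early perishing *)

Section concentration.
Context (R : realType) (T : nat) (M : model R T).
Implicit Types (t s : nat).

Lemma rho_max_ge0 : 0 <= rho_max M.
Proof. exact: bigmax_ge_id. Qed.

Definition regular (o : Omega M) : Prop := forall i : 'I_T * Theta M,
  (1 <= arrival M i.1.+1 i.2 o)%N /\
  `|Nreal M i.1.+1 i.2 o - Exp M (Nreal M i.1.+1 i.2)| <= rho_max M.

Lemma measurable_regular : measurable regular.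
Proof.
apply: measurable_of_same_data => o o' [ oa _] oreg i; have := oreg i.
by rewrite /Nreal oa// ltn_ord.
Qed.

Lemma prob_not_regular : prob (Pr M) (~` regular) = 0.
Proof.
pose A (i : 'I_T * Theta M) : set (Omega M) := ~` [set o |
  (1 <= arrival M i.1.+1 i.2 o)%N /\
  `|Nreal M i.1.+1 i.2 o - Exp M (Nreal M i.1.+1 i.2)| <= rho_max M].
have mA i : measurable (A i).
  apply/measurableC/measurable_of_same_data => o o' [ oa _] /=.
  by rewrite /Nreal oa// ltn_ord.
apply/eqP; rewrite eq_le prob_ge0 andbT.
apply: (@le_trans _ _ (\sum_i prob (Pr M) (A i))).
  apply: prob_le_sum => //; first exact/measurableC/measurable_regular.
  by move=> o /existsNP.
rewrite big1// => i _; rewrite /prob (measure_negligible (mA i))//.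
have iT : (1 <= i.1.+1 <= T)%N by rewrite ltn_ord.
apply: (negligibleS _ (negligibleU (arrival_ge1 i.2 iT) (arrival_dev i.2 iT))) => o.
move=> Ao; apply: contrapT => /not_orP[/contrapT n1 /contrapT n2]; apply: Ao.
split => //; apply: le_trans n2 _.
apply: (@le_trans _ _ (\big[Num.max/0]_theta rho M i.1.+1 theta)).
  exact: le_bigmax.
apply: (@le_bigmax_seq _ _ _ _ 0 i.1.+1 xpredT
  (fun t => \big[Num.max/0]_theta rho M t theta)) => //.
by rewrite mem_index_iota ltnS.
Qed.

Lemma prob_sub_not_regular (A : set (Omega M)) : measurable A ->
  A `<=` ~` regular -> prob (Pr M) A = 0.
Proof.
move=> mA sA; apply/eqP; rewrite eq_le prob_ge0 andbT -prob_not_regular.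
by apply: le_prob => //; exact/measurableC/measurable_regular.
Qed.

Definition arrival_bound : nat :=
  \max_(i : 'I_T * Theta M) Num.bound (Exp M (Nreal M i.1.+1 i.2) + rho_max M).

(** Values above the bound are sent to 0 by [inord]; this happens only outside [regular], a null
    set. *)
Definition truncated_arrival (i : 'I_T * Theta M) (o : Omega M) : 'I_arrival_bound.+1 :=
  inord (arrival M i.1.+1 i.2 o).

Lemma truncated_arrivalE i o : regular o ->
  (truncated_arrival i o : nat) = arrival M i.1.+1 i.2 o.
Proof.
move=> /(_ i)[_]; rewrite ler_norml => /andP[_ h]; rewrite inordK// ltnS.
apply: (leq_trans _ (leq_bigmax i)); rewrite -(ler_nat R).
apply/ltW/(le_lt_trans _ (archi_boundP _)); first by rewrite -lerBlDl.
by rewrite addr_ge0 ?rho_max_ge0// Exp_ge0.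
Qed.

Definition centered (i : 'I_T * Theta M) (k : 'I_arrival_bound.+1) : R :=
  k%:R - Exp M (Nreal M i.1.+1 i.2).

Lemma truncated_arrival_independent :
  (forall i x, measurable (truncated_arrival i @^-1` [set x])) /\
  forall x : 'I_T * Theta M -> 'I_arrival_bound.+1,
    prob (Pr M) [set o | forall i, truncated_arrival i o = x i] =
    \prod_i prob (Pr M) (truncated_arrival i @^-1` [set x i]).
Proof.
have inj : injective (@inl ('I_T * Theta M) (Unit M)) by move=> i j [].
have -> : truncated_arrival = fun i o => inord (match inl i with
    | inl (s, theta) => arrival M s.+1 theta o
    | inr b => perish M b o end).
  by apply/funext => -[].
exact: independent_images (fun _ => @inord arrival_bound) inj.
Qed.

(** The truncated variable equals the arrival almost everywhere, hence has the same mean. *)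
Lemma sum_centered i :
  \sum_x prob (Pr M) (truncated_arrival i @^-1` [set x]) * centered i x = 0.
Proof.
have [mZ _] := truncated_arrival_independent.
have iT : (1 <= i.1.+1 <= T)%N by rewrite ltn_ord.
under eq_bigr do rewrite mulrBr.
rewrite sumrB -mulr_suml sum_prob_preimage// mul1r.
apply/eqP; rewrite subr_eq0; apply/eqP; apply: EFin_inj.
rewrite -(expectation_finite (Pr M) (mZ i) (f := fun k : 'I_arrival_bound.+1 => k%:R))//.
rewrite /Exp fineK; last first.
  by rewrite expectation.unlock; apply: integrable_fin_num => //; exact: arrival_integrable.
rewrite expectation.unlock; apply: ae_eq_integral => //.
- move=> _ Y mY; apply: measurable_of_same_data => o o' [ oa _] /= [_ Yo].
  by split => //; rewrite /truncated_arrival -oa// ltn_ord.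
- move=> _ Y mY; apply: measurable_of_same_data => o o' [ oa _] /= [_ Yo].
  by split => //; rewrite /Nreal -oa// ltn_ord.
- exists (~` regular); split.
  + exact/measurableC/measurable_regular.
  + have := prob_not_regular; rewrite /prob => /eqP.
    by rewrite fine_eq0 ?fin_num_measure// => [/eqP//|];
      exact/measurableC/measurable_regular.
  + move=> o /= + oreg; apply; move=> _ /=.
    by rewrite truncated_arrivalE.
Qed.

(** A value violating the bound is taken only outside [regular], hence has probability zero. *)
Lemma centered_le i x :
  prob (Pr M) (truncated_arrival i @^-1` [set x]) != 0 -> `|centered i x| <= rho_max M.
Proof.
have [mZ _] := truncated_arrival_independent.
apply: contraNT => xr; apply/eqP/prob_sub_not_regular => // o /= Zx oreg.
move: xr; rewrite /centered -Zx truncated_arrivalE//.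
by have [_ ->] := oreg i.
Qed.

(** Ordinals count rounds from 0, so this stands for the rounds s + 1, ..., t. *)
Definition window s t : {set 'I_T * Theta M} :=
  [set i : 'I_T * Theta M | (s <= i.1 < t)%N]%SET.

Lemma sum_window s t (F : nat -> Theta M -> R) : (t <= T)%N ->
  \sum_(s.+1 <= u < t.+1) \sum_theta F u theta =
  \sum_(i in window s t) F i.1.+1 i.2.
Proof.
move=> tT; rewrite big_add1/= (big_nat_widen _ _ _ _ _ tT) (big_nat_widenl _ 0)//.
rewrite big_mkord pair_big_dep/=; apply: eq_bigl => i.
by rewrite inE andbT andbC.
Qed.

Lemma card_window s t : (t <= T)%N ->
  #|window s t|%:R = (t - s)%N%:R * #|Theta M|%:R :> R.
Proof.
move=> tT; rewrite -sum1_card natr_sum -(sum_window s (fun _ _ => 1%:R))//.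
under eq_bigr do rewrite -natr_sum sum1_card.
by rewrite sumr_const_nat subSS mulr_natl.
Qed.

Lemma prob_Nbetween_deviation delta s t : 0 < delta < 1 ->
  (0 < #|Theta M|)%N -> (s < t <= T)%N ->
  prob (Pr M) [set o | ConfN M delta s t <
    `|Nbetween M s.+1 t o - Exp M (Nbetween M s.+1 t)|] <= delta / T%:R ^+ 2.
Proof.
move=> /andP[d0 d1] Th0 /andP[st tT].
have T0 : (0 < T)%N by rewrite (leq_trans _ tT)// (leq_trans _ st).
have TR : 0 < T%:R :> R by rewrite ltr0n.
have T1 : 1 <= T%:R :> R by rewrite ler1n.
set A := [set o | _].
have mA : measurable A.
  apply: measurable_of_same_data => o o' oo; rewrite /A /=.
  by rewrite (same_data_Nbetween oo).
have dev o : regular o -> Nbetween M s.+1 t o - Exp M (Nbetween M s.+1 t) =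
    \sum_(i in window s t) centered i (truncated_arrival i o).
  move=> oreg; rewrite Exp_Nbetween//.
  have -> : Nbetween M s.+1 t o = \sum_(i in window s t) Nreal M i.1.+1 i.2 o.
    exact: (sum_window s (fun u theta => Nreal M u theta o)).
  rewrite (eq_big_nat _ _ (F2 := fun u => \sum_theta Exp M (Nreal M u theta))); last first.
    move=> u /andP[su ut]; rewrite (Exp_Nround M _).1//.
    by rewrite (leq_trans _ su)//= (leq_trans _ tT).
  rewrite (sum_window s (fun u theta => Exp M (Nreal M u theta)))// -sumrB.
  by apply: eq_bigr => i _; rewrite /centered truncated_arrivalE.
(* Hoeffding's bound requires a positive range. If rho_max = 0, then arrivals are almost surely
   constant and a strict deviation has probability zero. *)
have := rho_max_ge0; rewrite le_eqVlt => /predU1P[r0|r0].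
  rewrite prob_sub_not_regular ?divr_ge0 ?sqr_ge0 ?(ltW d0)//.
  move=> o + oreg; rewrite /A /= dev// /ConfN -r0 expr0n/= mulr0 mul0r sqrtr0 ltNge.
  move=> /negP; apply; rewrite normr_le0 big1// => i _.
  apply/eqP; rewrite -normr_le0 /centered truncated_arrivalE// r0.
  by have [_] := oreg i.
set c := ln (2 * T%:R ^+ 2 / delta).
have a0 : 0 < 2 * T%:R ^+ 2 / delta :> R by rewrite divr_gt0 ?mulr_gt0 ?exprn_gt0.
have c0 : 0 <= c.
  rewrite ln_ge0// ler_pdivlMr// mul1r (le_trans (ltW d1))//.
  by have := ler_pM ler01 ler01 T1 T1; rewrite -expr2; lra.
have [mZ iZ] := truncated_arrival_independent.
have W0 : (0 < #|window s t|)%N.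
  by rewrite -(ltr0n R) card_window// mulr_gt0 ?ltr0n// subn_gt0.
have H := hoeffding mZ iZ r0 c0 W0 (fun i _ => sum_centered i)
  (fun i x _ => @centered_le i x).
apply: (@le_trans _ _ (2 * expR (- c))); last first.
  rewrite /c expRN lnK ?posrE// invf_div.
  by rewrite le_eqVlt; apply/orP; left; apply/eqP; field; rewrite gt_eqF.
apply: le_trans H.
set D := [set o | Num.sqrt _ <= _].
have mD : measurable D.
  apply: (measurable_of_finite_family mZ) => o o' eqoo; rewrite /D /=.
  by under eq_bigr do rewrite eqoo.
have mN := measurableC measurable_regular.
rewrite -[leRHS]add0r -prob_not_regular; apply: le_trans (probU_le _ mN mD).
apply: le_prob => //; first exact: measurableU.
move=> o Ao; have [ oreg|] := pselect (regular o); last by left.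
right; move: Ao; rewrite /A /D /= dev// /ConfN card_window// mulrA.
exact: ltW.
Qed.

(** [ConfP] is the positive root c of c^2 = l * (2 e + c), where e = eta and l is its logarithm. The
    Chernoff exponent c^2 / (2 e + c) is therefore exactly l. *)
Lemma eta_ConfP_tail delta t : 0 < delta < 1 -> 1 <= ln (T%:R : R) -> (0 < t)%N ->
  prob (Pr M) [set o | eta M delta t + @ConfP R T delta t (eta M delta t) <
    \sum_(b | late_unit M delta t b) (perishes_early delta t b o)%:R] <=
  delta / (3 * ln T%:R) * t%:R^-1.
Proof.
move=> d01 lnT t0; have /andP[d0 d1] := d01.
have t1 : 1 <= t%:R :> R by rewrite ler1n.
have x3 : 3 <= 3 * t%:R * ln (T%:R : R).
  by have := ler_pM ler01 ler01 t1 lnT; rewrite -mulrA mulr1; lra.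
have x0 : 0 < 3 * t%:R * ln T%:R / delta by rewrite divr_gt0//; lra.
have l0 : 0 < ln (3 * t%:R * ln T%:R / delta) by rewrite ln_gt0// ltr_pdivlMr//; lra.
(* Including lateness in the indicator turns the sum over late units into one over all units, with
   the same mean. *)
pose early (b : Unit M) (n : nat) : bool := late_unit M delta t b && ((t <= n)%N &&
  (n%:R%:E < Order.min (T%:R : R)%:E (tau M delta b t (Xlow M delta)))%E).
have inj : injective (@inr ('I_T * Theta M) (Unit M)) by move=> i j [].
have [mZ iZ] := independent_images early inj.
have eE : eta M delta t = \sum_b prob (Pr M) [set o | early b (perish M b o)].
  rewrite /eta big_mkcond; apply: eq_bigr => b _; rewrite /early; case: ifPn => bl.
    by congr fine; congr (Pr M _); apply/seteqP; split => o /= => [[-> ->]|/andP[]].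
  by rewrite -(prob0 (Pr M)); congr prob; apply/seteqP; split.
set e := eta M delta t in eE *.
have e0 : 0 <= e by rewrite eE sumr_ge0// => b _; exact: prob_ge0.
set c := @ConfP R T delta t e.
set l := ln _ in l0.
have cE : c = (l + Num.sqrt (l ^+ 2 + 8 * e * l)) / 2 by [].
have D0 : 0 <= l ^+ 2 + 8 * e * l by rewrite addr_ge0 ?sqr_ge0// !mulr_ge0// ltW.
have c0 : 0 < c by rewrite cE; have := sqrtr_ge0 (l ^+ 2 + 8 * e * l); lra.
have c2 : c ^+ 2 = l * (2 * e + c).
  have := sqr_sqrtr D0; rewrite cE; set q := Num.sqrt _ => q2.
  by rewrite expr_div_n sqrrD q2; field.
have := chernoff_bernoulli mZ iZ eE c0.
rewrite c2 mulfK; last by rewrite gt_eqF//; lra.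
rewrite /l expRN lnK ?posrE// invf_div => h.
have <- : delta / (3 * t%:R * ln T%:R) = delta / (3 * ln T%:R) * t%:R^-1.
  by field; rewrite !gt_eqF//; lra.
apply: le_trans h; apply: le_prob.
- apply: measurable_of_same_data => o o' [_ op] /=.
  by under eq_bigr do rewrite /perishes_early op.
- apply: (measurable_of_finite_family mZ) => o o' eqoo /=.
  by under eq_bigr do rewrite eqoo.
- move=> o /ltW/le_trans; apply; rewrite big_mkcond; apply: ler_sum => b _.
  by rewrite /early /perishes_early; case: ifP.
Qed.

Lemma measurable_good_event delta : measurable (good_event (M := M) delta).
Proof. by apply: measurable_of_same_data => o o' oo; exact: (same_data_good oo). Qed.

Lemma prob_good_event delta : 0 < delta < 1 -> 1 <= ln (T%:R : R) ->
  (0 < #|Theta M|)%N -> 1 - 2 * delta <= prob (Pr M) (good_event (M := M) delta).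
Proof.
move=> d01 lnT Th0; have /andP[d0 d1] := d01; have mG := measurable_good_event delta.
have T0 : (0 < T)%N by case: T lnT => //; rewrite ln0// leNgt ltr01.
pose A (i : 'I_T * 'I_T) : set (Omega M) := [set o | (i.1 < i.2.+1)%N &&
  (ConfN M delta i.1 i.2.+1 <
    `|Nbetween M i.1.+1 i.2.+1 o - Exp M (Nbetween M i.1.+1 i.2.+1)|)].
pose D (i : 'I_T) : set (Omega M) :=
  [set o | eta M delta i.+1 + @ConfP R T delta i.+1 (eta M delta i.+1) <
    \sum_(b | late_unit M delta i.+1 b) (perishes_early delta i.+1 b o)%:R].
have mA i : measurable (A i).
  apply: measurable_of_same_data => o o' oo; rewrite /A /=.
  by rewrite (same_data_Nbetween oo)// ltn_ord.
have mD i : measurable (D i).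
  apply: measurable_of_same_data => o o' [_ op]; rewrite /D /=.
  by under eq_bigr do rewrite /perishes_early op.
have mN := measurableC measurable_regular.
(* One index type for all causes of failure: irregularity, a deviating window of rounds, or a
   spoilage forecast that is too low. *)
pose E (i : unit + 'I_T * 'I_T + 'I_T) : set (Omega M) :=
  match i with inl (inl _) => ~` regular | inl (inr i) => A i | inr i => D i end.
have : prob (Pr M) (~` good_event (M := M) delta) <= \sum_i prob (Pr M) (E i).
  apply: prob_le_sum; [exact: measurableC|by case=> [[]|]|].
  move=> o oG; apply: contrapT => oE; apply: oG.
  have nE i : ~ E i o by move=> Ei; apply: oE; exists i.
  split.
  - move=> t theta /andP[t1 tT]; have tT' : (t.-1 < T)%N by rewrite prednK.
    have /contrapT/(_ (Ordinal tT', theta)) := nE (inl (inl tt)).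
    by rewrite /= prednK.
  - move=> s t /andP[st tT]; have t0 : (0 < t)%N by exact: leq_ltn_trans st.
    have tT' : (t.-1 < T)%N by rewrite prednK.
    have := nE (inl (inr (Ordinal (leq_trans st tT), Ordinal tT'))).
    by rewrite /E /A /= prednK// st /= => /negP; rewrite -leNgt.
  - move=> t /andP[t1 tT]; have tT' : (t.-1 < T)%N by rewrite prednK.
    have := nE (inr (Ordinal tT')).
    by rewrite /E /D /= prednK// => /negP; rewrite -leNgt.
rewrite !big_sumType/= prob_not_regular big1_eq add0r.
have -> : prob (Pr M) (~` good_event (M := M) delta) =
    1 - prob (Pr M) (good_event (M := M) delta).
  by rewrite /prob probability_setC// fineB ?fin_num_measure.
have hA : \sum_i prob (Pr M) (A i) <= delta.
  apply: (@le_trans _ _ (\sum_(i : 'I_T * 'I_T) (delta / T%:R ^+ 2))).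
    apply: ler_sum => i _; have [i12|i12] := ltnP i.1 i.2.+1.
      rewrite (_ : A i = [set o | ConfN M delta i.1 i.2.+1 <
        `|Nbetween M i.1.+1 i.2.+1 o - Exp M (Nbetween M i.1.+1 i.2.+1)|]).
        by apply: prob_Nbetween_deviation => //; rewrite i12 ltn_ord.
      by rewrite /A i12.
    rewrite (_ : A i = set0) ?prob0 ?divr_ge0 ?sqr_ge0 ?(ltW d0)//.
    by apply/seteqP; split => // o; rewrite /A /= ltnNge i12.
  rewrite sumr_const card_prod !card_ord -[leLHS]mulr_natr natrM -expr2 divfK//.
  by rewrite expf_neq0// pnatr_eq0 -lt0n.
have hD : \sum_i prob (Pr M) (D i) <= delta.
  apply: (@le_trans _ _ (\sum_(i < T) (delta / (3 * ln T%:R) * i.+1%:R^-1))).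
    by apply: ler_sum => i _; exact: eta_ConfP_tail.
  rewrite -mulr_sumr.
  have := @harmonic_le_ln R T.-1; rewrite prednK// big_add1/= big_mkord => h.
  have l0 : 0 < 3 * ln T%:R :> R by lra.
  apply: (@le_trans _ _ (delta / (3 * ln T%:R) * (3 * ln T%:R))); last first.
    by rewrite divfK// gt_eqF.
  (* The factor 3 in the logarithm of [ConfP] absorbs the harmonic sum: 1 + ln T <= 3 ln T as ln T
     >= 1. *)
  by rewrite ler_wpM2l ?divr_ge0 ?(ltW d0) ?(ltW l0)//; apply: le_trans h _; lra.
by move: hA hD; lra.
Qed.

End concentration.

(** * The bounds with high probability *)

Lemma guardrail_high_probability (R : realType) (T : nat) (M : model R T)
    (delta L : R) :
  0 < L <= 1 -> 0 < delta < 1 -> 1 <= ln (T%:R : R) ->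
  0 < Exp M (Ntotal M) -> Xlow_attained M delta ->
  1 - 2 * delta <= prob (Pr M) [set o |
    [/\ Delta_EF M delta L o <= 6 * slack M delta 6 *
          Num.max L (Lperish M delta + 1 / Num.sqrt T%:R),
        Delta_efficiency M delta L o <= 6 * slack M delta 6 *
          (Num.min (Num.sqrt T%:R) (L^-1 + Num.sqrt (T%:R * L^-1 * Lperish M delta))
           + T%:R * Lperish M delta) &
        Envy M delta L o <= 6 * slack M delta 6 * L] ].
Proof.
move=> /andP[L0 L1] d01 lnT EN att.
apply: le_trans (prob_good_event d01 lnT (Theta_gt0 EN)) _.
apply: le_prob; first exact: measurable_good_event.
  apply: measurable_of_same_data => o o' oo /=.
  rewrite (same_data_Delta_EF oo) (same_data_Envy oo).
  by rewrite (same_data_Delta_efficiency oo).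
by move=> o good; exact: (guardrail_metrics L0 d01 lnT att EN good L1).
Qed.

(** By ln (1/2) <= - 1/2 one has ln 2 >= 1/2, and ln 4 is twice ln 2. *)
Lemma ln_ge1 (R : realType) (T : nat) : (4 <= T)%N -> 1 <= ln (T%:R : R).
Proof.
move=> T4; have : 1 / 2 <= ln 2 :> R.
  have := @le_ln1Dx R (- (1 / 2)).
  have -> : 1 + - (1 / 2) = 2^-1 :> R by field.
  by rewrite lnV ?posrE// => h; have := h ltac:(lra); lra.
have : ln (4%:R : R) <= ln T%:R by rewrite ler_ln ?posrE ?ltr0n ?ler_nat// (leq_trans _ T4).
rewrite -[4%N]/(2 * 2)%N natrM lnM ?posrE//; lra.
Qed.

Theorem theorem4 (R : realType) :
  exists (C : R) (k : nat), 0 < C /\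
  forall (M : forall T : nat, model R T) (L : nat -> R),
    (fun T => Exp (M T) (Ntotal (M T))) \is 'Theta_\oo (fun T : nat => T%:R : R) ->
    (fun T => beta_avg (M T)) \is 'Theta_\oo (fun _ : nat => 1 : R) ->
    L =o_\oo (fun _ : nat => 1 : R) ->
    (forall T, 0 < L T) ->
    \forall T \near \oo, forall delta : R, 0 < delta < 1 ->
      Xlow_attained (M T) delta ->
      ((1 - 2 * delta)%:E <= Pr (M T) [set o | (
        [/\ Delta_EF (M T) delta (L T) o <=
              C * slack (M T) delta k *
              Num.max (L T) (Lperish (M T) delta + 1 / Num.sqrt T%:R),
            Delta_efficiency (M T) delta (L T) o <=
              C * slack (M T) delta k *
              (Num.min (Num.sqrt T%:R)
                 ((L T)^-1 +
                  Num.sqrt (T%:R * (L T)^-1 * Lperish (M T) delta)) +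
               T%:R * Lperish (M T) delta) &
            Envy (M T) delta (L T) o <= C * slack (M T) delta k * L T])%R])%E.
Proof.
exists 6, 6%N; split => // M L /asboolP[[k1 k2] /andP[/= k10 _] ENT] _ /eqoP Lo L0.
(* T is taken large enough for T >= 4, L T <= 1 and a positive expected number of arrivals. None of
   these involves delta, so one threshold on T serves all delta. *)
near=> T => delta d01 att.
have T4 : (4 <= T)%N by near: T; exact: nbhs_infty_ge.
have TR : 0 < T%:R :> R by rewrite ltr0n (leq_trans _ T4).
have L1 : L T <= 1.
  have : `|L T| <= 1 * `|1 : R| by near: T; exact: Lo.
  by rewrite normr1 mulr1 (gtr0_norm (L0 T)).
have EN : 0 < Exp (M T) (Ntotal (M T)).
  have [+ _] : k1 * `|T%:R : R| <= `|Exp (M T) (Ntotal (M T))| /\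
      `|Exp (M T) (Ntotal (M T))| <= k2 * `|T%:R : R| by near: T; exact: ENT.
  rewrite (ger0_norm (Exp_ge0 _)); last by move=> o; exact: Nbetween_ge0.
  by apply: lt_le_trans; rewrite mulr_gt0// normr_gt0 gt_eqF.
have L01 : 0 < L T <= 1 by rewrite L0.
have := guardrail_high_probability L01 d01 (ln_ge1 R T4) EN att.
rewrite -lee_fin -probE//.
apply: measurable_of_same_data => o o' oo /=.
rewrite (same_data_Delta_EF oo) (same_data_Envy oo).
by rewrite (same_data_Delta_efficiency oo).
Unshelve. all: by end_near. Qed.
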